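(* Let $d,e\ge1$ be integers and let $R$ be the coordinate ring of the weighted rational curve of type $(d,e)$, with homogeneous maximal ideal $\mathfrak m$. Then $R$ is generalized (nonstandard) Koszul; that is, the associated graded ring $\mathrm{gr}_{\mathfrak m}(R)$ is Koszul in the usual sense.
   Context: Let $k$ be a field and $S=k[x_0,\dots,x_{d-1},y_0,\dots,y_{e-1}]$, graded by $\deg x_i=1$, $\deg y_i=e$. Let $\varphi:S\to k[s,t]$ be the $k$-algebra map with $\varphi(x_i)=s^{d-i}t^i$ for $0\le i\le d-1$ and $\varphi(y_i)=s^{e-1-i}t^{ed-(e-1)+i}$ for $0\le i\le e-1$. The weighted rational curve of type $(d,e)$ has defining ideal $I=\ker\varphi$ and coordinate ring $R=S/I$. The ideal $\mathfrak m$ is the ideal of $R$ generated by the images of all $x_i$ and $y_i$. The associated graded ring is $\mathrm{gr}_{\mathfrak m}(R)=\bigoplus_{u\ge0}\mathfrak m^u/\mathfrak m^{u+1}$, a standard graded $k$-algebra. A standard graded $k$-algebra $A$ is Koszul (in the usual sense) if the minimal graded free resolution of $k$ over $A$ is linear, i.e. $\mathrm{Tor}_i^A(k,k)_j=0$ for all $i\ne j$. *)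

(* Defs.v *)
From HB Require Import structures.
From mathcomp Require Import all_boot all_algebra.
From mathcomp Require Import ring_quotient mpoly.
From mathcomp Require boolp.

Set Implicit Arguments.
Unset Strict Implicit.
Unset Printing Implicit Defensive.

Import GRing.Theory.
Local Open Scope ring_scope.
Local Open Scope quotient_scope.

Definition is_grading (A : comNzRingType) (G : nat -> A -> Prop) : Prop :=
  [/\ forall u, G u 0 /\ (forall x y, G u x -> G u y -> G u (x - y)),
      G 0%N 1,
      forall u v x y, G u x -> G v y -> G (u + v)%N (x * y),
      forall x, exists n (f : nat -> A),
        (forall u, G u (f u)) /\ x = \sum_(u < n) f u
    & forall n (f : nat -> A), (forall u, G u (f u)) ->
        \sum_(u < n) f u = 0 -> forall u, (u < n)%N -> f u = 0].

(* N-graded commutative rings A = A_0 (+) A_1 (+) ...; [gr_piece A u] is A_u. *)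
Record gradedRing := GradedRing {
  gr_ring :> comNzRingType;
  gr_piece : nat -> gr_ring -> Prop;
  gr_pieceP : is_grading gr_piece
}.

(* The irrelevant ideal A_+ = A_1 (+) A_2 (+) ... *)
Definition irrelevant (A : gradedRing) (x : A) : Prop :=
  exists n (f : nat -> A),
    (forall u, gr_piece u.+1 (f u)) /\ x = \sum_(u < n) f u.

(* Data for a complex  ... -> F_2 -> F_1 -> F_0 -> A/A_+  with                *)
(*   F_i = (+)_(a < res_rank i) A(- res_shift i a),                           *)
(* so that the a-th basis vector of F_i has degree [res_shift i a].  Elements *)
(* of F_i are row vectors; F_(i+1) -> F_i is v |-> v *m res_diff i, and       *)
(* F_0 -> A/A_+ is v |-> v *m res_aug modulo A_+.                             *)
Record resData (A : gradedRing) := ResData {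
  res_rank : nat -> nat;
  res_shift : forall i, 'I_(res_rank i) -> nat;
  res_diff : forall i, 'M[A]_(res_rank i.+1, res_rank i);
  res_aug : 'cV[A]_(res_rank 0)
}.

Definition aug_map (A : gradedRing) (F : resData A)
    (v : 'rV[A]_(res_rank F 0)) : A :=
  (v *m res_aug F) ord0 ord0.

(* The maps preserve degrees; A/A_+ lives in degree 0. *)
Definition res_graded (A : gradedRing) (F : resData A) : Prop :=
  (forall a, gr_piece (res_shift (i := 0) a) (res_aug F a ord0)) /\
  forall i a b,
    res_diff F i a b = 0 \/
    exists2 u, res_shift a = (u + res_shift b)%N
             & gr_piece u (res_diff F i a b).

Definition res_exact (A : gradedRing) (F : resData A) : Prop :=
  [/\ forall x : A, exists v : 'rV_(res_rank F 0), irrelevant (x - aug_map v),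
      forall v : 'rV_(res_rank F 0),
        irrelevant (aug_map v) <-> exists w, v = w *m res_diff F 0
    & forall i (v : 'rV_(res_rank F i.+1)),
        v *m res_diff F i = 0 <-> exists w, v = w *m res_diff F i.+1].

Definition graded_free_resolution (A : gradedRing) (F : resData A) : Prop :=
  res_graded F /\ res_exact F.

(* The image of F_(i+1) -> F_i is contained in A_+ F_i. *)
Definition res_minimal (A : gradedRing) (F : resData A) : Prop :=
  forall i a b, irrelevant (res_diff F i a b).

(* F_i is generated in degree i.  When F is minimal, Tor_i(A/A_+, A/A_+)_j is *)
(* free over A/A_+ on the basis vectors of F_i of degree j, so this is the    *)
(* vanishing of Tor_i(A/A_+, A/A_+)_j for all i <> j.                         *)
Definition res_linear (A : gradedRing) (F : resData A) : Prop :=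
  forall i (a : 'I_(res_rank F i)), res_shift a = i.

(* The minimal graded free resolution is unique up to isomorphism; the base   *)
(* field of a standard graded algebra A is recovered as A/A_+.                *)
Definition koszul (A : gradedRing) : Prop :=
  exists F : resData A,
    [/\ graded_free_resolution F, res_minimal F & res_linear F].

Section AssociatedGraded.
Variables (R : comNzRingType) (J : idealr R).

Fixpoint ideal_pow (u : nat) : R -> Prop :=
  if u is v.+1 then fun a =>
    exists n (f g : 'I_n -> R),
      [/\ forall i, f i \in J, forall i, ideal_pow v (g i)
        & a = \sum_(i < n) f i * g i]
  else fun _ => True.

Lemma ideal_pow0 u : ideal_pow u 0.
Proof.
case: u => [//|u] /=; exists 0%N, (fun=> 0), (fun=> 0).
by split => [[]|[]|] //; rewrite big_ord0.
Qed.

Lemma ideal_powM u c a : ideal_pow u a -> ideal_pow u (c * a).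
Proof.
case: u => [//|u] [n [f [g [Jf Jg ->]]]].
exists n, (fun i => c * f i), g; split => //.
  by move=> i; apply: idealMr.
by rewrite mulr_sumr; apply: eq_bigr => i _; rewrite mulrA.
Qed.

Lemma ideal_powD u a b : ideal_pow u a -> ideal_pow u b -> ideal_pow u (a + b).
Proof.
case: u => [//|u] [n [f [g [Jf Jg ->]]]] [m [f' [g' [Jf' Jg' ->]]]].
pose h (T : Type) (x : 'I_n -> T) (y : 'I_m -> T) (i : 'I_(n + m)) :=
  match split i with inl j => x j | inr j => y j end.
exists (n + m)%N, (h _ f f'), (h _ g g'); split.
- by move=> i; rewrite /h; case: (split i).
- by move=> i; rewrite /h; case: (split i).
rewrite big_split_ord /=; congr (_ + _); apply: eq_bigr => i _; rewrite /h.
- by rewrite -[lshift m i]/(unsplit (inl i)) unsplitK.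
- by rewrite -[rshift n i]/(unsplit (inr i)) unsplitK.
Qed.

Lemma ideal_powB u a b : ideal_pow u a -> ideal_pow u b -> ideal_pow u (a - b).
Proof.
by move=> Ja Jb; apply: ideal_powD => //; rewrite -mulN1r; apply: ideal_powM.
Qed.

Lemma ideal_pow_sum u n (f : 'I_n -> R) :
  (forall i, ideal_pow u (f i)) -> ideal_pow u (\sum_(i < n) f i).
Proof.
by move=> Jf; apply: big_ind => //; [apply: ideal_pow0 | apply: ideal_powD].
Qed.

Lemma ideal_pow_mul u v a b :
  ideal_pow u a -> ideal_pow v b -> ideal_pow (u + v) (a * b).
Proof.
elim: u a => [a _|u IH a]; first exact: ideal_powM.
move=> [n [f [g [Jf Jg ->]]]] Jb; rewrite addSn.
exists n, f, (fun i => g i * b); split => //.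
  by move=> i; apply: (IH _ (Jg i) Jb).
by rewrite mulr_suml; apply: eq_bigr => i _; rewrite mulrA.
Qed.

Lemma ideal_pow1 a : ideal_pow 1 a -> a \in J.
Proof.
move=> [n [f [g [Jf _ ->]]]]; apply: rpred_sum => i _.
by rewrite mulrC; apply: idealMr.
Qed.

(* (+)_u J^u, presented as the Rees ring: the polynomials \sum_u a_u T^u with *)
(* a_u in J^u.                                                                *)
Definition rees : {pred {poly R}} :=
  fun p => boolp.asbool (forall u, ideal_pow u p`_u).

Lemma reesP (p : {poly R}) : reflect (forall u, ideal_pow u p`_u) (p \in rees).
Proof. exact: boolp.asboolP. Qed.

Lemma rees_subring : subring_closed rees.
Proof.
split.
- apply/reesP => u; rewrite coefC; case: u => [//|u]; exact: ideal_pow0.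
- move=> p q /reesP Jp /reesP Jq; apply/reesP => u.
  by rewrite coefB; apply: ideal_powB.
- move=> p q /reesP Jp /reesP Jq; apply/reesP => u.
  rewrite coefM; apply: ideal_pow_sum => i.
  have := ideal_pow_mul (Jp i) (Jq (u - i)%N).
  by rewrite subnKC // -ltnS.
Qed.

HB.instance Definition _ :=
  GRing.isSubringClosed.Build {poly R} rees rees_subring.

Record reesRing := ReesRing { rees_val :> {poly R}; _ : rees_val \in rees }.

HB.instance Definition _ := [isSub for rees_val].
HB.instance Definition _ := [Choice of reesRing by <:].
HB.instance Definition _ := [SubChoice_isSubComNzRing of reesRing by <:].

(* (+)_u J^(u+1) inside (+)_u J^u *)
Definition rees_shift : {pred reesRing} :=
  fun p => boolp.asbool (forall u, ideal_pow u.+1 (val p)`_u).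

Lemma rees_shiftP (p : reesRing) :
  reflect (forall u, ideal_pow u.+1 (val p)`_u) (p \in rees_shift).
Proof. exact: boolp.asboolP. Qed.

Lemma rees_shift_ideal : idealr_closed rees_shift.
Proof.
split.
- by apply/rees_shiftP => u; rewrite rmorph0 coef0; apply: ideal_pow0.
- apply/negP => /rees_shiftP /(_ 0%N); rewrite rmorph1 coefC eqxx.
  by move/ideal_pow1; rewrite idealr1.
move=> a p q /rees_shiftP Jp /rees_shiftP Jq; apply/rees_shiftP => u.
rewrite rmorphD rmorphM coefD; apply: ideal_powD => //.
rewrite coefM; apply: ideal_pow_sum => i.
have /reesP Ja := valP a.
have := ideal_pow_mul (Ja i) (Jp (u - i)%N).
by rewrite addnS subnKC // -ltnS.
Qed.

HB.instance Definition _ := isIdealr.Build reesRing rees_shift rees_shift_ideal.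

(* ((+)_u J^u) / ((+)_u J^(u+1)) = (+)_u J^u / J^(u+1) *)
Definition assoc_graded_ring : comNzRingType := {ideal_quot rees_shift}.

(* J^u / J^(u+1) *)
Definition assoc_graded_piece (u : nat) (x : assoc_graded_ring) : Prop :=
  exists (a : R) (p : reesRing),
    val p = a *: 'X^u /\ x = \pi_{ideal_quot rees_shift} p.

Lemma assoc_graded_pi0 (q : reesRing) :
  \pi_{ideal_quot rees_shift} q = 0 :> assoc_graded_ring <-> q \in rees_shift.
Proof.
rewrite -[q in q \in _]subr0 Quotient.idealrBE.
have -> : (0 : assoc_graded_ring) = \pi_{ideal_quot rees_shift} 0.
  by rewrite rmorph0.
by split=> /eqP.
Qed.

Lemma rees_monP u a : ideal_pow u a -> a *: 'X^u \in rees.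
Proof.
move=> Ja; apply/reesP => v; rewrite coefZ coefXn.
by case: eqP => [->|_]; rewrite ?mulr1 ?mulr0 //; apply: ideal_pow0.
Qed.

Lemma assoc_graded_grading : is_grading assoc_graded_piece.
Proof.
split.
- move=> u; split; first by exists 0, 0; rewrite scale0r !rmorph0.
  move=> _ _ [a [p [ep ->]]] [b [q [eq_ ->]]].
  exists (a - b), (p - q); split; last by rewrite rmorphB.
  by rewrite [LHS]/= ep eq_ scalerBl.
- by exists 1, 1; rewrite scale1r !rmorph1.
- move=> u v _ _ [a [p [ep ->]]] [b [q [eq_ ->]]].
  exists (a * b), (p * q); split; last by rewrite rmorphM.
  by rewrite [LHS]/= ep eq_ -scalerAl -scalerAr scalerA exprD.
- move=> x; pose p := repr x; have /reesP Jp := valP p.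
  pose m u := ReesRing (rees_monP (Jp u)).
  exists (size (val p)), (fun u => \pi_{ideal_quot rees_shift} (m u)); split.
    by move=> u; exists (val p)`_u, (m u).
  rewrite -rmorph_sum /= -[x in LHS]reprK; congr (\pi _); apply: val_inj.
  by rewrite rmorph_sum /= -[LHS]coefK poly_def.
move=> n f Gf s0 u ltun.
have /boolp.choice [p Hp] : forall v, exists q : reesRing,
    (exists a : R, val q = a *: 'X^v) /\ f v = \pi_{ideal_quot rees_shift} q.
  by move=> v; have [a [q [eq_ ->]]] := Gf v; exists q; split => //; exists a.
move: s0; under eq_bigr => i _ do rewrite (Hp i).2.
rewrite -rmorph_sum => /assoc_graded_pi0 /rees_shiftP Js.
rewrite (Hp u).2; apply/assoc_graded_pi0/rees_shiftP => v.
have [a ea] := (Hp u).1; rewrite ea coefZ coefXn.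
case: eqP => [->|_]; rewrite ?mulr1 ?mulr0; last exact: ideal_pow0.
have := Js u; rewrite rmorph_sum coef_sum /=.
rewrite (bigD1 (Ordinal ltun)) //= ea coefZ coefXn eqxx mulr1 big1 ?addr0 //.
move=> i; rewrite -val_eqE /= => neiu; have [b ->] := (Hp i).1.
by rewrite coefZ coefXn eq_sym (negbTE neiu) mulr0.
Qed.

Definition assoc_graded : gradedRing := GradedRing assoc_graded_grading.

End AssociatedGraded.

Definition generalized_koszul (R : comNzRingType) (J : idealr R) : Prop :=
  koszul (assoc_graded J).

Section WeightedRationalCurve.
Variables (k : fieldType) (d e : nat).

Let s : {mpoly k[2]} := 'X_ord0.
Let t : {mpoly k[2]} := 'X_ord_max.

(* The d + e variables of S are x_0, ..., x_(d-1), y_0, ..., y_(e-1), in this *)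
(* order.  For d, e >= 1 none of the subtractions below is truncated.         *)
Definition wrc_mono (j : 'I_(d + e)) : {mpoly k[2]} :=
  match split j with
  | inl i => s ^+ (d - i) * t ^+ i
  | inr i => s ^+ (e - 1 - i) * t ^+ (e * d - (e - 1) + i)
  end.

Definition wrc_phi (p : {mpoly k[d + e]}) : {mpoly k[2]} :=
  p \mPo [tuple wrc_mono j | j < d + e].

Definition wrc_ker : {pred {mpoly k[d + e]}} := fun p => wrc_phi p == 0.

Lemma wrc_ker_ideal : idealr_closed wrc_ker.
Proof.
split; rewrite /in_mem /= /wrc_ker /wrc_phi.
- by rewrite comp_mpoly0.
- by rewrite comp_mpoly1 oner_eq0.
move=> a u v; rewrite /in_mem /= => /eqP u0 /eqP v0.
by rewrite comp_mpolyD rmorphM /= u0 v0 mulr0 addr0.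
Qed.

HB.instance Definition _ :=
  isIdealr.Build {mpoly k[d + e]} wrc_ker wrc_ker_ideal.

Definition wrc_ring : comNzRingType := {ideal_quot wrc_ker}.

Definition wrc_gen (j : 'I_(d + e)) : wrc_ring := \pi_{ideal_quot wrc_ker} 'X_j.

Definition wrc_max_pred : {pred wrc_ring} := fun x =>
  boolp.asbool (exists c : 'I_(d + e) -> wrc_ring,
    x = \sum_(j < d + e) c j * wrc_gen j).

Hypotheses (hd : (0 < d)%N) (he : (0 < e)%N).

Lemma wrc_mono0 j : (wrc_mono j).@[fun=> 0] = 0.
Proof.
rewrite /wrc_mono; case: (split j) => i.
  rewrite mevalM !rmorphXn /= !mevalXU !expr0n subn_eq0 leqNgt ltn_ord.
  by rewrite mul0r.
rewrite mevalM !rmorphXn /= !mevalXU !expr0n addn_eq0 !subn_eq0.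
have -> : (e * d <= e - 1)%N = false.
  by apply/negbTE; rewrite -ltnNge subn1 prednK // leq_pmulr.
by rewrite mulr0.
Qed.

Lemma wrc_max_ideal_closed : idealr_closed wrc_max_pred.
Proof.
split.
- apply/boolp.asboolP; exists (fun=> 0).
  by rewrite big1 // => j _; rewrite mul0r.
- apply/negP => /boolp.asboolP [c].
  under eq_bigr => j _ do rewrite -[c j]reprK /wrc_gen -rmorphM.
  rewrite -rmorph_sum -(rmorph1 \pi) /= => /eqP.
  rewrite -Quotient.idealrBE /in_mem /= /wrc_ker /wrc_phi => /eqP.
  move/(congr1 (meval (fun=> 0))); rewrite meval0 rmorphB rmorph1 rmorph_sum /=.
  rewrite mevalB meval1 (raddf_sum (meval _)) big1 /= ?subr0.
    by move/eqP; rewrite oner_eq0.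
  move=> j _; rewrite rmorphM /= comp_mpolyXU mevalM.
  by rewrite -tnth_nth tnth_mktuple wrc_mono0 mulr0.
move=> a x y /boolp.asboolP [c ->] /boolp.asboolP [c' ->].
apply/boolp.asboolP; exists (fun j => a * c j + c' j).
rewrite mulr_sumr -big_split /=; apply: eq_bigr => j _.
by rewrite mulrDl mulrA.
Qed.

End WeightedRationalCurve.

Definition wrc_max_ideal (k : fieldType) (d e : nat)
    (hd : (0 < d)%N) (he : (0 < e)%N) : idealr (wrc_ring k d e) :=
  HB.pack (@wrc_max_pred k d e)
    (isIdealr.Build (wrc_ring k d e) _ (wrc_max_ideal_closed k hd he)).

(* Main.v *)
(* The ring gr_m(R) has the regular sequence th1 = x_(d-1), th2 = x_0 +       *)
(* y_(e-1) of linear forms, and m^2 = th1 m + th2 m, so that modulo (th1,     *)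
(* th2) it becomes k (+) V with V^2 = 0.  Over k (+) V the residue field has  *)
(* the resolution with i-th term indexed by the words of length i in a basis  *)
(* of V, and a linear resolution modulo a linear nonzerodivisor lifts.        *)
(*                                                                            *)
(* The facts about R are monomial.  R is identified with its image in k[s,t], *)
(* and a monomial s^p t^q is a product of a of the x's, b of the y's and      *)
(* possibly further generators as soon as p + q = d(a + eb) and a <= p, so    *)
(* m^u is spanned by the monomials for which some such a, b have a + b >= u.  *)

Require Import Defs.
From mathcomp Require Import all_boot all_algebra.
From mathcomp Require Import ring_quotient mpoly.
From mathcomp Require boolp.
From mathcomp Require Import ring zify.

Set Implicit Arguments.
Unset Strict Implicit.
Unset Printing Implicit Defensive.

Import GRing.Theory.
Local Open Scope ring_scope.
Local Open Scope quotient_scope.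

(** * Homogeneous components *)

(** Koszulness lifts along a linear nonzerodivisor th. A linear resolution of k over A/th, lifted to
    matrices over A, has composites equal to th times a linear homotopy, and the cone built from
    that homotopy resolves k over A ([double_res_linear]). Two such lifts reduce [koszul_criterion]
    to a ring k + V with V^2 = 0, where every syzygy module is a sum of copies of V, hence of k, and
    the resolution is visibly linear ([word_res_linear]). [generalized_koszul_criterion] rephrases
    the hypotheses in terms of the powers m^u.

    For the curve, th1 = s t^(d-1) and th2 = s^d + t^(ed) in k[s,t]. Since m^u is spanned by
    monomials ([Jpow_supp], [supp_Jpow]), the order of s^p t^q is read off from the ways of writing
    (p + q)/d = a + e b with a <= p, and a is determined modulo e. Because of this congruence, th1
    raises the order of a monomial by exactly one ([order_ge_reg1]). A monomial that survives modulo
    th1 in gr_m(R) either has t-exponent below d - 1, or is a product of y's with s-exponent below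
    e; x_0 acts without loss on the first kind and y_(e-1) on the second ([order_ge_reg2]). Finally
    m^2 = th1 m + th2 m, because a monomial of m^2 outside th1 m enters it once a factor x_0 is
    exchanged for y_(e-1) or conversely ([order_ge_quad]). *)

Section GradedComponents.
Variable A : gradedRing.
Implicit Types (x y : A) (u v n : nat) (f : nat -> A).

Lemma gr_piece0 u : gr_piece u (0 : A).
Proof. by case: (gr_pieceP A) => h _ _ _ _; have [] := h u. Qed.

Lemma gr_piece1 : gr_piece 0 (1 : A).
Proof. by case: (gr_pieceP A). Qed.

Lemma gr_pieceB u x y : gr_piece u x -> gr_piece u y -> gr_piece u (x - y).
Proof. by case: (gr_pieceP A) => h _ _ _ _; have [_] := h u; apply. Qed.

Lemma gr_pieceN u x : gr_piece u x -> gr_piece u (- x).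
Proof. by rewrite -sub0r; apply/gr_pieceB/gr_piece0. Qed.

Lemma gr_pieceD u x y : gr_piece u x -> gr_piece u y -> gr_piece u (x + y).
Proof. by move=> hx hy; rewrite -[y]opprK; apply/gr_pieceB/gr_pieceN. Qed.

Lemma gr_piece_sum u (I : Type) (r : seq I) (P : pred I) (F : I -> A) :
  (forall i, P i -> gr_piece u (F i)) -> gr_piece u (\sum_(i <- r | P i) F i).
Proof.
by move=> h; apply: big_ind => //; [apply: gr_piece0 | apply: gr_pieceD].
Qed.

Lemma gr_pieceM u v x y :
  gr_piece u x -> gr_piece v y -> gr_piece (u + v) (x * y).
Proof. by case: (gr_pieceP A) => _ _ h _ _; apply: h. Qed.

Lemma gr_decomp x : exists nf : nat * (nat -> A),
  (forall u, gr_piece u (nf.2 u)) /\ x = \sum_(u < nf.1) nf.2 u.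
Proof.
by case: (gr_pieceP A) => _ _ _ h _; have [n [f]] := h x; exists (n, f).
Qed.

(** The decomposition is obtained by choice, and its family carries no information beyond the length
    of the sum, hence the cut-off to 0. [gr_compE] makes the result independent of the choice. *)
Definition gr_comp x u : A :=
  let nf := projT1 (boolp.cid (gr_decomp x)) in
  if (u < nf.1)%N then nf.2 u else 0.

Lemma sum_widen n m f : (n <= m)%N ->
  \sum_(u < n) f u = \sum_(u < m) (if (u < n)%N then f u else 0).
Proof.
by move=> le; rewrite (big_ord_widen _ f le) big_mkcond.
Qed.

Lemma gr_compE n f x u : (forall u, gr_piece u (f u)) ->
  x = \sum_(u < n) f u -> gr_comp x u = if (u < n)%N then f u else 0.
Proof.
rewrite /gr_comp; case: (boolp.cid _) => -[m g] /= [Gg xg] Gf xf.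
apply/eqP; rewrite -subr_eq0; apply/eqP.
(* Both sums are padded with zeros to a common length exceeding [u], so that uniqueness applies to
   their difference in degree [u]. *)
pose N := (maxn (maxn m n) u).+1.
have lm : (m <= N)%N by rewrite /N; lia.
have ln : (n <= N)%N by rewrite /N; lia.
pose h v := (if (v < m)%N then g v else 0) - (if (v < n)%N then f v else 0).
rewrite -/(h u); case: (gr_pieceP A) => _ _ _ _ /(_ N h); apply.
- by move=> v; apply: gr_pieceB; case: ifP => _ //; apply: gr_piece0.
- by rewrite sumrB -!sum_widen // -xg -xf subrr.
- by rewrite /N; lia.
Qed.

Lemma gr_comp_piece x u : gr_piece u (gr_comp x u).
Proof.
rewrite /gr_comp; case: (boolp.cid _) => -[m g] /= [Gg _].
by case: ifP => _ //; apply: gr_piece0.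
Qed.

Lemma gr_comp_sum x : exists n, forall m, (n <= m)%N ->
  x = \sum_(u < m) gr_comp x u.
Proof.
have [[n f] /= [Gf xf]] := gr_decomp x; exists n => m le.
rewrite [LHS]xf (sum_widen _ le); apply: eq_bigr => i _.
by rewrite (gr_compE _ Gf xf).
Qed.

Lemma gr_compB x y u : gr_comp (x - y) u = gr_comp x u - gr_comp y u.
Proof.
have [n hx] := gr_comp_sum x; have [m hy] := gr_comp_sum y.
pose N := (maxn (maxn m n) u).+1.
rewrite (@gr_compE N (fun v => gr_comp x v - gr_comp y v)).
- by rewrite ifT // /N; lia.
- by move=> v; apply: gr_pieceB; apply: gr_comp_piece.
- by rewrite sumrB -hx -?hy // /N; lia.
Qed.

Lemma gr_comp0 u : gr_comp 0 u = 0.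
Proof. by rewrite -[X in gr_comp X](subrr 0) gr_compB subrr. Qed.

Lemma gr_compD x y u : gr_comp (x + y) u = gr_comp x u + gr_comp y u.
Proof.
by rewrite -[y in LHS]opprK gr_compB -[- y]sub0r gr_compB gr_comp0 sub0r opprK.
Qed.

Lemma gr_comp_bigsum (I : Type) (r : seq I) (F : I -> A) u :
  gr_comp (\sum_(i <- r) F i) u = \sum_(i <- r) gr_comp (F i) u.
Proof.
by elim/big_rec2: _ => [|i y z _ <-]; rewrite ?gr_comp0 ?gr_compD.
Qed.

Lemma gr_comp_hom x u v :
  gr_piece u x -> gr_comp x v = if v == u then x else 0.
Proof.
move=> Gx; rewrite (@gr_compE u.+1 (fun w => if w == u then x else 0)).
- by rewrite ltnS; case: eqP => [->|]; rewrite ?leqnn ?if_same.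
- by move=> w; case: eqP => [->|_] //; apply: gr_piece0.
- rewrite big_ord_recr /= eqxx big1 ?add0r // => i _.
  by rewrite (ltn_eqF (ltn_ord i)).
Qed.

Lemma gr_compMl u x y v :
  gr_piece u x -> gr_comp (x * y) (u + v) = x * gr_comp y v.
Proof.
move=> Gx; have [n hy] := gr_comp_sum y.
rewrite {1}(hy _ (leq_maxl n v.+1)) mulr_sumr gr_comp_bigsum.
have lv : (v < maxn n v.+1)%N by lia.
rewrite (bigD1 (Ordinal lv)) //= big1 ?addr0 => [|i].
  by rewrite (gr_comp_hom _ (gr_pieceM Gx (gr_comp_piece _ _))) eqxx.
rewrite -val_eqE /= => ne.
rewrite (gr_comp_hom _ (gr_pieceM Gx (gr_comp_piece _ _))) eqn_add2l.
by rewrite eq_sym (negbTE ne).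
Qed.

Lemma gr_eq x y : gr_comp x =1 gr_comp y -> x = y.
Proof.
move=> e; have [n hx] := gr_comp_sum x; have [m hy] := gr_comp_sum y.
rewrite (hx _ (leq_maxl n m)) (hy _ (leq_maxr n m)).
by apply: eq_bigr.
Qed.

Lemma irrelevantP x : irrelevant x <-> gr_comp x 0 = 0.
Proof.
split=> [[n [f [Gf ->]]]|x0].
  rewrite gr_comp_bigsum big1 // => i _.
  by rewrite (gr_comp_hom _ (Gf i)).
have [n hx] := gr_comp_sum x; exists n, (fun u => gr_comp x u.+1); split.
  by move=> u; apply: gr_comp_piece.
by rewrite {1}(hx n.+1) // big_ord_recl x0 add0r.
Qed.

End GradedComponents.

(** * Lifting linear resolutions along a nonzerodivisor *)

Section ResolutionModIdeal.
Variable A : gradedRing.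

Definition ideal_closed (I : A -> Prop) : Prop :=
  I 0 /\ forall c x y, I x -> I y -> I (c * x + y).

Definition mx_in (I : A -> Prop) m n (M : 'M[A]_(m, n)) : Prop :=
  forall i j, I (M i j).

Section MxIn.
Variables (I : A -> Prop) (hI : ideal_closed I).

Lemma ideal_closedD x y : I x -> I y -> I (x + y).
Proof. by move=> Ix Iy; rewrite -[x]mul1r; apply: hI.2. Qed.

Lemma ideal_closedM c x : I x -> I (c * x).
Proof. by move=> Ix; rewrite -[c * x]addr0; apply: hI.2 => //; apply: hI.1. Qed.

Lemma ideal_closedB x y : I x -> I y -> I (x - y).
Proof.
move=> Ix Iy; apply: ideal_closedD => //.
by rewrite -mulN1r; apply: ideal_closedM.
Qed.

Lemma ideal_closed_sum (T : Type) (r : seq T) (P : pred T) (F : T -> A) :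
  (forall i, P i -> I (F i)) -> I (\sum_(i <- r | P i) F i).
Proof.
by move=> h; apply: big_ind => //; [apply: hI.1 | apply: ideal_closedD].
Qed.

Lemma mx_in0 m n : mx_in I (0 : 'M_(m, n)).
Proof. by move=> i j; rewrite mxE; apply: hI.1. Qed.

Lemma mx_inD m n (M N : 'M_(m, n)) : mx_in I M -> mx_in I N -> mx_in I (M + N).
Proof. by move=> hM hN i j; rewrite mxE; apply: ideal_closedD. Qed.

Lemma mx_inB m n (M N : 'M_(m, n)) : mx_in I M -> mx_in I N -> mx_in I (M - N).
Proof. by move=> hM hN i j; rewrite !mxE; apply: ideal_closedB. Qed.

Lemma mx_inMl m n p (M : 'M_(m, n)) (N : 'M_(n, p)) :
  mx_in I N -> mx_in I (M *m N).
Proof.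
move=> hN i j; rewrite mxE; apply: ideal_closed_sum => k _.
exact: ideal_closedM.
Qed.

Lemma mx_inMr m n p (M : 'M_(m, n)) (N : 'M_(n, p)) :
  mx_in I M -> mx_in I (M *m N).
Proof.
move=> hM i j; rewrite mxE; apply: ideal_closed_sum => k _.
by rewrite mulrC; apply: ideal_closedM.
Qed.

End MxIn.

(* The matrices of F have entries in A, but F is only a complex, and exact,   *)
(* after reduction modulo I.                                                  *)
Definition linear_resolution_mod (I : A -> Prop) (F : resData A) : Prop :=
  [/\ forall i (a : 'I_(res_rank F i)), res_shift a = i,
      forall a, gr_piece 0 (res_aug F a ord0),
      forall i a b, gr_piece 1 (res_diff F i a b)
    & [/\ forall x : A, exists v : 'rV_(res_rank F 0),
            irrelevant (x - aug_map v),
          forall v : 'rV_(res_rank F 0), irrelevant (aug_map v) <->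
            exists w, mx_in I (v - w *m res_diff F 0)
        & forall i (v : 'rV_(res_rank F i.+1)), mx_in I (v *m res_diff F i) <->
            exists w, mx_in I (v - w *m res_diff F i.+1)]].

Lemma mx_in_zero m n (M : 'M[A]_(m, n)) : mx_in (eq^~ 0) M <-> M = 0.
Proof.
by split=> [h|-> i j]; [apply/matrixP => i j; rewrite mxE | rewrite mxE].
Qed.

(** Minimality is automatic: the entries of a linear differential have degree 1, so their degree 0
    component vanishes. *)
Lemma koszul_of_resolution (F : resData A) :
  linear_resolution_mod (eq^~ 0) F -> koszul A.
Proof.
case=> hs ha hd [surj ex0 ex]; exists F; split=> //.
- split; first split=> //.
  + by move=> a; rewrite hs.
  + by move=> i a b; right; exists 1%N => //; rewrite !hs add1n.
  split=> //.
  + move=> v; rewrite ex0; split=> -[w e]; exists w.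
      by apply/eqP; rewrite -subr_eq0; apply/eqP/mx_in_zero.
    by apply/mx_in_zero; rewrite e subrr.
  + move=> i v; rewrite -mx_in_zero ex; split=> -[w e]; exists w.
      by apply/eqP; rewrite -subr_eq0; apply/eqP/mx_in_zero.
    by apply/mx_in_zero; rewrite e subrr.
- by move=> i a b; apply/irrelevantP; rewrite (gr_comp_hom _ (hd _ _ _)).
Qed.

(* Write the composites of F, which vanish modulo (I, th), as d d = th h      *)
(* modulo I.  Then F_i (+) F_(i-1)(-1) with differential                      *)
(* (v, w) |-> (v d + th w, - v h - w d) is a resolution modulo I.             *)
Section Doubling.
Variables (I : A -> Prop) (hI : ideal_closed I) (th : A) (Gth : gr_piece 1 th).

Definition ideal_adjoin (x : A) : Prop := exists y, I (x - th * y).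

Lemma ideal_adjoin_closed : ideal_closed ideal_adjoin.
Proof.
split; first by exists 0; rewrite mulr0 subrr; apply: hI.1.
move=> c x y [x' Ix] [y' Iy]; exists (c * x' + y').
have -> : c * x + y - th * (c * x' + y') = c * (x - th * x') + (y - th * y').
  by ring.
exact: hI.2.
Qed.

Lemma mx_in_adjoin m n (M : 'M[A]_(m, n)) :
  mx_in ideal_adjoin M <-> exists N, mx_in I (M - th *: N).
Proof.
split=> [h|[N h] i j]; last by exists (N i j); have := h i j; rewrite !mxE.
have /boolp.choice [N hN] : forall ij, exists y, I (M ij.1 ij.2 - th * y).
  by case=> i j; apply: h.
by exists (\matrix_(i, j) N (i, j)) => i j; rewrite !mxE; apply: (hN (i, j)).
Qed.

Hypothesis reg : forall x, I (th * x) -> I x.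
Hypothesis quad : forall x, gr_piece 2 x -> ideal_adjoin x ->
  exists2 y, gr_piece 1 y & I (x - th * y).

Lemma mx_reg m n (M : 'M[A]_(m, n)) : mx_in I (th *: M) -> mx_in I M.
Proof. by move=> h i j; apply: reg; have := h i j; rewrite mxE. Qed.

Section Construction.
Variables (F : resData A) (hF : linear_resolution_mod ideal_adjoin F).
Let r := res_rank F.
Let d := res_diff F.

Lemma double_diff_quad i : mx_in ideal_adjoin (d i.+1 *m d i).
Proof.
case: hF => _ _ _ [_ _ ex] a b.
(* A row of [d i.+1] is the image of a basis vector, hence a cycle by the easy half of exactness. *)
have /ex h : exists w,
    mx_in ideal_adjoin (row a (d i.+1) - w *m res_diff F i.+1).
  exists (delta_mx 0 a); rewrite -rowE subrr.
  exact: (mx_in0 ideal_adjoin_closed).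
by have := h 0 b; rewrite -row_mul mxE.
Qed.

(** The entries of d d are quadrics in the ideal generated by [I] and [th]; [quad] divides them by
    [th] with a linear quotient, which keeps the doubled complex linear. *)
Lemma homotopy_exists i : exists h : 'M[A]_(r i.+2, r i),
  (forall a b, gr_piece 1 (h a b)) /\ mx_in I (d i.+1 *m d i - th *: h).
Proof.
have /boolp.choice [h hh] : forall ab : 'I_(r i.+2) * 'I_(r i), exists y,
    gr_piece 1 y /\ I ((d i.+1 *m d i) ab.1 ab.2 - th * y).
  case=> a b /=.
  have [||y Gy Iy] := @quad ((d i.+1 *m d i) a b); last by exists y.
    rewrite mxE; apply: gr_piece_sum => j _; rewrite -[2%N]/(1 + 1)%N.
    by apply: gr_pieceM; case: hF => _ _ hd _; apply: hd.
  exact: double_diff_quad.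
exists (\matrix_(a, b) h (a, b)); split=> a b; rewrite !mxE.
  by have [] := hh (a, b).
by have [_] := hh (a, b); rewrite mxE.
Qed.

Let h i : 'M[A]_(r i.+2, r i) := projT1 (boolp.cid (homotopy_exists i)).

Let h1 i a b : gr_piece 1 (h i a b).
Proof. by rewrite /h; case: (boolp.cid _) => ? []. Qed.

Let dd i : mx_in I (d i.+1 *m d i - th *: h i).
Proof. by rewrite /h; case: (boolp.cid _) => ? []. Qed.

(** The triple composite d d d is th h d and also th d h modulo [I]; regularity cancels [th]. *)
Let hd_comm i : mx_in I (h i.+1 *m d i - d i.+2 *m h i).
Proof.
apply: mx_reg.
have -> : th *: (h i.+1 *m d i - d i.+2 *m h i) =
    d i.+2 *m (d i.+1 *m d i - th *: h i)
    - (d i.+2 *m d i.+1 - th *: h i.+1) *m d i.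
  rewrite mulmxBr mulmxBl mulmxA -scalemxAr -scalemxAl.
  move: (_ *m _ *m _) (h i.+1 *m _) (d i.+2 *m h i) => M1 M2 M3.
  by apply/matrixP => a b; rewrite !mxE; ring.
by apply: (mx_inB hI); [apply: (mx_inMl hI) | apply: (mx_inMr hI)].
Qed.

Definition double_rank i : nat :=
  if i is j.+1 then (r j.+1 + r j)%N else r 0.

Definition double_diff i : 'M[A]_(double_rank i.+1, double_rank i) :=
  match i with
  | 0 => col_mx (d 0) th%:M
  | j.+1 => block_mx (d j.+1) (- h j) th%:M (- d j)
  end.

Definition double_res : resData A :=
  @ResData A double_rank (fun i _ => i) double_diff (res_aug F).

Lemma double_diff_sqr i : mx_in I (double_diff i.+1 *m double_diff i).
Proof.
case: i => [|i] /=.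
  rewrite mul_block_col => a b; rewrite mxE; case: splitP => j _.
    rewrite mulNmx mul_mx_scalar; exact: dd.
  by rewrite mulNmx mul_mx_scalar mul_scalar_mx subrr mxE; apply: hI.1.
rewrite mulmx_block; move: (@dd i.+1) (@dd i) (@hd_comm i) => dd1 dd0 hd a b.
rewrite mxE; case: splitP => j _; rewrite mxE; case: splitP => l _.
- rewrite mulNmx mul_mx_scalar; exact: dd1.
- rewrite mulmxN mulNmx mulmxN opprK addrC; exact: hd.
- by rewrite mulNmx mul_mx_scalar mul_scalar_mx subrr mxE; apply: hI.1.
- rewrite mulNmx !mulmxN opprK mul_scalar_mx addrC; exact: dd0.
Qed.

(** The first component v1 of a cycle (v1, v2) is a cycle of [F] modulo [I] and [th], so it equals w
    d + th u modulo [I]. The pair (w, u) is then a preimage of the whole cycle: its second component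
    agrees with v2 after multiplication by [th], hence modulo [I] by regularity. *)
Lemma double_res_linear : linear_resolution_mod I double_res.
Proof.
case: (hF) => hs ha hd [surj ex0 ex]; split=> //.
- move=> [|i] a b /=; rewrite mxE; case: splitP => j _.
  + exact: hd.
  + rewrite mxE; case: eqP => _; rewrite ?mulr1n ?mulr0n //; exact: gr_piece0.
  + rewrite mxE; case: splitP => l _; first exact: hd.
    by rewrite mxE; apply/gr_pieceN/h1.
  + rewrite mxE; case: splitP => l _; last by rewrite mxE; apply/gr_pieceN/hd.
    rewrite mxE; case: eqP => _; rewrite ?mulr1n ?mulr0n //; exact: gr_piece0.
split=> //.
- move=> v; rewrite ex0; split.
    move=> [w /mx_in_adjoin [N hN]]; exists (row_mx w N) => /=.
    by rewrite mul_row_col mul_mx_scalar opprD addrA.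
  move=> [w]; rewrite -[w]hsubmxK /= mul_row_col mul_mx_scalar => hw.
  exists (lsubmx w); apply/mx_in_adjoin; exists (rsubmx w).
  by rewrite opprD addrA in hw.
move=> i v; split; last first.
  move=> [w hw]; rewrite /= -[v](subrK (w *m double_diff i.+1)) mulmxDl.
  apply: (mx_inD hI); first exact: (mx_inMr hI).
  by rewrite -mulmxA; apply: (mx_inMl hI); apply: double_diff_sqr.
rewrite -[v]hsubmxK; move: (lsubmx v) (rsubmx v) => v1 v2 hv.
have [w hw] : exists w, mx_in ideal_adjoin (v1 - w *m res_diff F i.+1).
  apply/ex/mx_in_adjoin; exists (- v2).
  rewrite scalerN opprK -mul_mx_scalar.
  case: i v v1 v2 hv => [|i] v v1 v2 /=; first by rewrite mul_row_col.
  rewrite mul_row_block => hv a b; have := hv a (lshift _ b).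
  by rewrite row_mxEl.
move/mx_in_adjoin: hw => [u hu]; exists (row_mx w u).
rewrite [res_diff _ _]/= mul_row_block mul_mx_scalar opp_row_mx add_row_mx.
have hv2 : mx_in I (v2 - (w *m - h i + u *m - d i)).
  (* Multiplied by [th], the claim becomes a combination of three things known to lie in [I]: the
     first half of the cycle condition, the error [e], and d d - th h. *)
  apply: mx_reg; set e := v1 - w *m _ - _ in hu.
  have : mx_in I (v1 *m d i + th *: v2).
    case: i v v1 v2 hv w u e hu => [|i] v v1 v2 /= hv w u e hu.
      by move: hv; rewrite mul_row_col mul_mx_scalar.
    move: hv; rewrite mul_row_block mul_mx_scalar => hv a b.
    by have := hv a (lshift _ b); rewrite row_mxEl.
  have -> : th *: (v2 - (w *m - h i + u *m - d i)) =
      (v1 *m d i + th *: v2) - e *m d i - w *m (d i.+1 *m d i - th *: h i).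
    rewrite /e !mulmxBl mulmxBr !mulmxN -scalemxAl -scalemxAr mulmxA.
    rewrite -/d; move: (v1 *m d i) (w *m d i.+1 *m d i) (w *m h i) (u *m d i).
    move=> M1 M2 M3 M4.
    by apply/matrixP => a b; rewrite !mxE; ring.
  move=> hvd; apply: (mx_inB hI); last by apply: (mx_inMl hI).
  by apply: (mx_inB hI) => //; apply: (mx_inMr hI).
move=> a b; rewrite mxE; case: splitP => j _.
  by rewrite opprD addrA; apply: hu.
exact: hv2.
Qed.
End Construction.
End Doubling.
End ResolutionModIdeal.

(** * Koszulness from a regular sequence of linear forms *)

Section KoszulCriterion.
Variables (A : gradedRing) (th1 th2 : A) (N : nat) (z : 'cV[A]_N).
Hypotheses (Gth1 : gr_piece 1 th1) (Gth2 : gr_piece 1 th2).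
Hypothesis Gz : forall j, gr_piece 1 (z j 0).
Hypothesis std : forall u (x : A), gr_piece u.+1 x ->
  exists a b (c : 'rV_N), x = th1 * a + th2 * b + (c *m z) 0 0.
Hypothesis zz : forall i j, exists a b, z i 0 * z j 0 = th1 * a + th2 * b.
Hypothesis reg1 : forall u (x : A), gr_piece u x -> th1 * x = 0 -> x = 0.
Hypothesis reg2 : forall u (x y : A), gr_piece u x -> gr_piece u y ->
  th2 * x = th1 * y -> exists b, x = th1 * b.
Hypothesis indep : forall (c : 'rV[A]_N) a b,
  (forall j, gr_piece 0 (c 0 j)) -> gr_piece 0 a -> gr_piece 0 b ->
  (c *m z) 0 0 = th1 * a + th2 * b -> c = 0.

Let I0 : A -> Prop := eq^~ 0.
Let I1 := ideal_adjoin I0 th1.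
Let I2 := ideal_adjoin I1 th2.

Let hI0 : ideal_closed I0.
Proof. by split=> [|c x y -> ->]; rewrite /I0 // mulr0 addr0. Qed.

Let hI1 : ideal_closed I1 := ideal_adjoin_closed hI0 th1.
Let hI2 : ideal_closed I2 := ideal_adjoin_closed hI1 th2.

Let I1P x : I1 x <-> exists a, x = th1 * a.
Proof.
split=> -[a e]; exists a; last by rewrite /I0 e subrr.
by apply/eqP; rewrite -subr_eq0 e.
Qed.

Let I2P x : I2 x <-> exists a b, x = th1 * a + th2 * b.
Proof.
split=> [[b /I1P [a e]]|[a [b ->]]].
  by exists a, b; rewrite -e subrK.
by exists b; apply/I1P; exists a; rewrite addrK.
Qed.

Let reg0 x : I0 (th1 * x) -> I0 x.
Proof.
move=> e; apply: gr_eq => u; rewrite gr_comp0.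
apply: (reg1 (gr_comp_piece x u)).
by rewrite -(gr_compMl _ _ Gth1) e gr_comp0.
Qed.

Let reg1' x : I1 (th2 * x) -> I1 x.
Proof.
move=> /I1P [y e]; apply/I1P.
(* [reg2] is assumed only for homogeneous elements, so the quotient is found degree by degree and
   then summed. *)
have /boolp.choice [b hb] : forall u, exists b, gr_comp x u = th1 * b.
  move=> u; apply: (reg2 (gr_comp_piece x u) (gr_comp_piece y u)).
  by rewrite -(gr_compMl _ _ Gth2) e (gr_compMl _ _ Gth1).
have [n hn] := gr_comp_sum x; exists (\sum_(u < n) b u).
by rewrite [LHS](hn n) // mulr_sumr; apply: eq_bigr.
Qed.

Let quad0 x : gr_piece 2 x -> I1 x ->
  exists2 y, gr_piece 1 y & I0 (x - th1 * y).
Proof.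
move=> Gx /I1P [y e]; exists (gr_comp y 1); first exact: gr_comp_piece.
by rewrite -(gr_compMl _ _ Gth1) -e (gr_comp_hom _ Gx) subrr.
Qed.

Let quad1 x : gr_piece 2 x -> I2 x ->
  exists2 y, gr_piece 1 y & I1 (x - th2 * y).
Proof.
move=> Gx /I2P [a [b e]]; exists (gr_comp b 1); first exact: gr_comp_piece.
apply/I1P; exists (gr_comp a 1).
rewrite -(gr_compMl _ _ Gth2) -(gr_compMl _ _ Gth1); apply/eqP.
by rewrite subr_eq -gr_compD -e (gr_comp_hom _ Gx).
Qed.

(* The differential sends the basis vector of a word (b, j) to z_j times that *)
(* of b.                                                                      *)
Fixpoint word_rank i : nat := if i is j.+1 then (word_rank j * N)%N else 1%N.

Definition word_diff i : 'M[A]_(word_rank i.+1, word_rank i) :=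
  lin1_mx (trmx \o mulmxr z \o vec_mx).

Lemma word_diffE i v : v *m word_diff i = (vec_mx v *m z)^T.
Proof. exact: mul_rV_lin1. Qed.

Definition word_res : resData A :=
  @ResData A word_rank (fun i _ => i) word_diff (const_mx 1).

Lemma irrelevant_decomp x : irrelevant x ->
  exists c : 'rV_N, I2 (x - (c *m z) 0 0).
Proof.
move=> [n [f [Gf ->]]].
have /boolp.choice [c hc] : forall u, exists c : 'rV_N, I2 (f u - (c *m z) 0 0).
  move=> u; have [a [b [c ->]]] := std (Gf u); exists c; apply/I2P.
  by exists a, b; rewrite addrK.
exists (\sum_(u < n) c u); rewrite mulmx_suml summxE -sumrB.
by apply: (ideal_closed_sum hI2) => i _; apply: hc.
Qed.

Lemma irrelevantMl t x : gr_piece 1 t -> irrelevant (A := A) (t * x).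
Proof.
move=> Gt; have [n hx] := gr_comp_sum x; exists n, (fun u => t * gr_comp x u).
split=> [u|]; first exact/(gr_pieceM Gt)/gr_comp_piece.
by rewrite [in LHS](hx n) // mulr_sumr.
Qed.

Lemma irrelevantD (x y : A) :
  irrelevant x -> irrelevant y -> irrelevant (A := A) (x + y).
Proof. by rewrite !irrelevantP gr_compD => -> ->; rewrite addr0. Qed.

Lemma irrelevant_adjoin x (c : 'rV_N) :
  I2 (x - (c *m z) 0 0) -> irrelevant x.
Proof.
move=> /I2P [a [b e]]; rewrite -[x](subrK ((c *m z) 0 0)) e.
apply: irrelevantD; first by apply: irrelevantD; apply: irrelevantMl.
rewrite mxE; apply: big_ind => [|x1 x2|j _]; last 2 first.
- exact: irrelevantD.
- by rewrite mulrC; apply: irrelevantMl.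
- by apply/irrelevantP; rewrite gr_comp0.
Qed.

(** Modulo th1 and th2, the annihilator of [z] consists of the vectors with irrelevant entries:
    [indep] removes the constant terms of a relation, and [zz] gives the converse. Irrelevant
    entries are in turn combinations of [z], that is, images from the next term. *)
Lemma word_exact m (V : 'M[A]_(m, N)) :
  mx_in I2 (V *m z) <->
  exists w : 'rV_(m * N * N), mx_in I2 (mxvec V - (vec_mx w *m z)^T).
Proof.
split=> [hV|[w hw]]; last first.
  move=> i o; rewrite ord1 mxE; apply: (ideal_closed_sum hI2) => j _.
  set k := mxvec_index i j; pose W := vec_mx w : 'M_(m * N, N).
  have -> : V i j * z j 0 = z j 0 * (mxvec V - (W *m z)^T) 0 k
      + \sum_l W k l * (z l 0 * z j 0).
    have -> : (mxvec V - (W *m z)^T) 0 k = V i j - \sum_l W k l * z l 0.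
      by rewrite -[V i j]mxvecE -/k mxE; congr (_ + _); rewrite !mxE.
    rewrite mulrBr mulr_sumr [z j 0 * _]mulrC -addrA -sumrN -big_split big1 /=.
      by rewrite addr0.
    by move=> l _; ring.
  apply: (ideal_closedD hI2); first exact: (ideal_closedM hI2).
  apply: (ideal_closed_sum hI2) => l _; apply: (ideal_closedM hI2).
  exact/I2P.
have irr k : irrelevant (mxvec V 0 k).
  case/mxvec_indexP: k => i j; rewrite mxvecE.
  have /I2P [a [b e]] := hV i 0.
  apply/irrelevantP.
  (* In degree 1 the relation involves only the degree 0 components of its coefficients, which is
     the form required by [indep]. *)
  have : \row_l gr_comp (V i l) 0 = 0 :> 'rV_N.
    apply: (indep (a := gr_comp a 0) (b := gr_comp b 0)).
    - by move=> l; rewrite mxE; apply: gr_comp_piece.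
    - exact: gr_comp_piece.
    - exact: gr_comp_piece.
    have comp1 t x : gr_piece 1 t -> t * gr_comp x 0 = gr_comp (t * x) 1.
      by move=> Gt; rewrite -(gr_compMl _ _ Gt).
    rewrite !comp1 // -gr_compD -e !mxE gr_comp_bigsum.
    by apply: eq_bigr => l _; rewrite mxE mulrC comp1 // mulrC.
  by move/matrixP/(_ 0 j); rewrite !mxE.
have /boolp.choice [c hc] : forall k,
    exists c : 'rV_N, I2 (mxvec V 0 k - (c *m z) 0 0).
  by move=> k; apply: irrelevant_decomp.
exists (mxvec (\matrix_(k, j) c k 0 j)) => i k; rewrite ord1 mxvecK.
have := hc k; rewrite !mxE; congr (I2 (_ - _)); apply: eq_bigr => j _.
by rewrite mxE.
Qed.

Lemma word_res_linear : linear_resolution_mod I2 word_res.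
Proof.
split=> //.
- by move=> a; rewrite mxE; apply: gr_piece1.
- move=> i a b; have -> : res_diff word_res i a b = (row a (word_diff i)) 0 b.
    by rewrite [RHS]mxE.
  rewrite rowE word_diffE mxE mxE; apply: gr_piece_sum => j _.
  apply: (gr_pieceM (u := 0%N) (v := 1%N)) => //.
  rewrite !mxE; case: (_ && _); [exact: gr_piece1 | exact: gr_piece0].
split.
- move=> x; exists x%:M; exists 0%N, (fun=> 0); split=> [u|].
    exact: gr_piece0.
  by rewrite big_ord0 /aug_map mul_scalar_mx !mxE mulr1 subrr.
- move=> v.
  have -> : aug_map (F := word_res) v = v 0 0.
    rewrite /aug_map mxE big_ord_recl big_ord0 addr0 mxE mulr1.
    by congr (v _ _); apply: val_inj.
  split=> [/irrelevant_decomp [c hc]|[w hw]].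
    exists (mxvec c) => a b; rewrite word_diffE mxvecK !ord1 !mxE.
    by move: hc; rewrite mxE.
  apply: (@irrelevant_adjoin _ (vec_mx w)).
  by have := hw 0 0; rewrite word_diffE [X in I2 X]mxE [in X in _ + X]mxE mxE.
move=> i v; rewrite word_diffE.
apply: (iff_trans (B := mx_in I2 (vec_mx v *m z))).
  by split=> h a b; have := h b a; rewrite [_^T _ _]mxE.
apply: (iff_trans (word_exact _)); rewrite vec_mxK.
by split=> -[w hw]; exists w; move: hw; rewrite word_diffE.
Qed.

(** The word resolution modulo (th1, th2) is doubled along th2 and then along th1. *)
Theorem koszul_criterion : koszul A.
Proof.
have [F1 h1] : exists F, linear_resolution_mod I1 F.
  by eexists; apply: (double_res_linear hI1 Gth2 reg1' quad1 word_res_linear).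
have [F0 h0] : exists F, linear_resolution_mod I0 F.
  by eexists; apply: (double_res_linear hI0 Gth1 reg0 quad0 h1).
exact: koszul_of_resolution h0.
Qed.

End KoszulCriterion.

(** * The associated graded ring *)

Section Symbols.
Variables (R : comNzRingType) (J : idealr R).
Implicit Types (a b : R) (u v : nat).

(** The default 0 is returned when this polynomial is not in the Rees ring, which is why the lemmas
    on [symbol] assume membership in powers of [J]. *)
Definition rees_mon u a : reesRing J := insubd 0 (a *: 'X^u : {poly R}).

Definition symbol u a : assoc_graded J :=
  \pi_{ideal_quot (@rees_shift R J)} (rees_mon u a).

Lemma rees_monE u a : ideal_pow J u a -> val (rees_mon u a) = a *: 'X^u.
Proof. by move=> Ja; rewrite insubdK //; apply: rees_monP. Qed.

Lemma symbolP u (x : assoc_graded J) :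
  gr_piece u x <-> exists2 a, ideal_pow J u a & x = symbol u a.
Proof.
split=> [[a [p [ep ->]]]|[a Ja ->]]; last first.
  by exists a, (rees_mon u a); split=> //; apply: rees_monE.
have Ja : ideal_pow J u a.
  have /reesP/(_ u) := valP p.
  by rewrite [val p]ep coefZ coefXn eqxx mulr1.
exists a => //; congr (\pi _); apply: val_inj.
by rewrite rees_monE // -ep.
Qed.

Lemma symbol_piece u a : ideal_pow J u a -> gr_piece u (symbol u a).
Proof. by move=> Ja; apply/symbolP; exists a. Qed.

Lemma symbolD u a b : ideal_pow J u a -> ideal_pow J u b ->
  symbol u (a + b) = symbol u a + symbol u b.
Proof.
move=> Ja Jb; rewrite /symbol -[RHS]rmorphD; congr (\pi _); apply: val_inj.
rewrite [RHS]rmorphD /= -!/(val _) !rees_monE ?scalerDl //.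
exact: ideal_powD.
Qed.

Lemma symbolM u v a b : ideal_pow J u a -> ideal_pow J v b ->
  symbol (u + v) (a * b) = symbol u a * symbol v b.
Proof.
move=> Ja Jb; rewrite /symbol -[RHS]rmorphM; congr (\pi _); apply: val_inj.
rewrite [RHS]rmorphM /= -!/(val _) !rees_monE //; last exact: ideal_pow_mul.
by rewrite -scalerAl -scalerAr scalerA exprD.
Qed.

Lemma symbol_eq0 u a : ideal_pow J u a ->
  symbol u a = 0 <-> ideal_pow J u.+1 a.
Proof.
move=> Ja; rewrite assoc_graded_pi0; split=> [/rees_shiftP/(_ u)|Ja1].
  by rewrite rees_monE // coefZ coefXn eqxx mulr1.
apply/rees_shiftP => v; rewrite rees_monE // coefZ coefXn.
by case: eqP => [->|_]; rewrite ?mulr1 ?mulr0 //; apply: ideal_pow0.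
Qed.

Lemma symbol0 u : symbol u 0 = 0.
Proof. by apply/symbol_eq0; apply: ideal_pow0. Qed.

Lemma symbolB u a b : ideal_pow J u a -> ideal_pow J u b ->
  symbol u (a - b) = symbol u a - symbol u b.
Proof.
move=> Ja Jb; apply/eqP; rewrite -subr_eq opprK -symbolD ?subrK //.
exact: ideal_powB.
Qed.

Lemma symbol_sum u n (f : 'I_n -> R) : (forall i, ideal_pow J u (f i)) ->
  symbol u (\sum_i f i) = \sum_i symbol u (f i).
Proof.
move=> Jf; suff [] : ideal_pow J u (\sum_i f i) /\
  symbol u (\sum_i f i) = \sum_i symbol u (f i) by [].
elim/big_rec2: _ => [|i y x _ [Jy <-]].
  by split; [exact: ideal_pow0 | exact: symbol0].
by split; [exact: ideal_powD | exact: symbolD].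
Qed.

Lemma ideal_pow1P a : a \in J -> ideal_pow J 1 a.
Proof.
move=> Ja; exists 1%N, (fun=> a), (fun=> 1); split=> //.
by rewrite big_ord1 mulr1.
Qed.

Lemma ideal_pow_le u v a : (u <= v)%N -> ideal_pow J v a -> ideal_pow J u a.
Proof.
move=> /subnK <-; elim: (v - u)%N a => [//|w IH] a.
rewrite addSn => -[n [f [g [_ Jg ->]]]].
by apply: IH; apply: ideal_pow_sum => i; apply/ideal_powM/Jg.
Qed.

End Symbols.

(** * The Koszul criterion in terms of powers of an ideal *)

Section AssociatedGradedCriterion.
Variables (R : comNzRingType) (J : idealr R) (t1 t2 : R).
Variables (N : nat) (z : 'I_N -> R).
Notation Jpow := (ideal_pow J).
Hypotheses (Jt1 : t1 \in J) (Jt2 : t2 \in J) (Jz : forall j, z j \in J).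
Hypothesis gen : forall x, x \in J ->
  exists a b (c : 'I_N -> R), x = t1 * a + t2 * b + \sum_j c j * z j.
Hypothesis zz : forall i j, exists a b,
  [/\ a \in J, b \in J & z i * z j = t1 * a + t2 * b].
Hypothesis reg1 : forall u a, Jpow u a -> Jpow u.+2 (t1 * a) -> Jpow u.+1 a.
Hypothesis reg2 : forall u a b, Jpow u a -> Jpow u b ->
  Jpow u.+2 (t2 * a - t1 * b) ->
  exists2 b', Jpow u.-1 b' & Jpow u.+1 (a - t1 * b').
Hypothesis indep : forall (c : 'I_N -> R) a b,
  Jpow 2 (\sum_j c j * z j - (t1 * a + t2 * b)) -> forall j, c j \in J.

Let sz : 'cV[assoc_graded J]_N := \col_j symbol J 1 (z j).

Let Jt1' := ideal_pow1P Jt1.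
Let Jt2' := ideal_pow1P Jt2.
Let Jz' j := ideal_pow1P (Jz j).

Lemma generalized_koszul_criterion : generalized_koszul J.
Proof.
apply: (@koszul_criterion _ (symbol J 1 t1) (symbol J 1 t2) N sz).
- exact: symbol_piece.
- exact: symbol_piece.
- by move=> j; rewrite mxE; apply: symbol_piece.
- move=> u _ /symbolP [_ [n [f [g [Jf Jg ->]]]] ->].
  have /boolp.choice [h hh] : forall i, exists abc : R * R * ('I_N -> R),
      f i = t1 * abc.1.1 + t2 * abc.1.2 + \sum_j abc.2 j * z j.
    by move=> i; have [a [b [c ->]]] := gen (Jf i); exists (a, b, c).
  exists (symbol J u (\sum_i (h i).1.1 * g i)).
  exists (symbol J u (\sum_i (h i).1.2 * g i)).
  exists (\row_j symbol J u (\sum_i (h i).2 j * g i)).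
  have Js (c : 'I_n -> R) : Jpow u (\sum_i c i * g i).
    by apply: ideal_pow_sum => i; apply: ideal_powM; exact: Jg.
  rewrite mxE; under [X in _ = _ + X]eq_bigr => j _.
    rewrite !mxE mulrC -symbolM //; over.
  have JM t s : Jpow 1 t -> Jpow u s -> Jpow (1 + u) (t * s).
    exact: ideal_pow_mul.
  rewrite -symbol_sum => [|j]; last exact: JM.
  rewrite -!symbolM // -symbolD; try exact: JM.
  rewrite -symbolD; first 1 last.
  + by apply: ideal_powD; apply: JM.
  + by apply: ideal_pow_sum => j; apply: JM.
  congr (symbol J _ _); rewrite !mulr_sumr -!big_split /=.
  under [X in _ = _ + X]eq_bigr => j _ do rewrite mulr_sumr.
  rewrite exchange_big -big_split /=; apply: eq_bigr => i _.
  rewrite hh mulrDl mulr_suml mulrDl !mulrA; congr (_ + _).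
  by apply: eq_bigr => j _; ring.
- move=> i j; have [a [b [Ja Jb e]]] := zz i j.
  move: (ideal_pow1P Ja) (ideal_pow1P Jb) => {}Ja {}Jb.
  exists (symbol J 1 a), (symbol J 1 b); rewrite !mxE -!symbolM // e.
  by apply: symbolD; apply: (ideal_pow_mul (u := 1) (v := 1)).
- move=> u _ /symbolP [a Ja ->]; rewrite -symbolM // => /symbol_eq0 h.
  apply/symbol_eq0 => //; apply: reg1 => //; apply: h.
  exact: (ideal_pow_mul (u := 1)).
- move=> u _ _ /symbolP [a Ja ->] /symbolP [b Jb ->].
  rewrite -!symbolM // => /eqP; rewrite -subr_eq0 -symbolB; last first.
  + exact: (ideal_pow_mul (u := 1)).
  + exact: (ideal_pow_mul (u := 1)).
  move=> /eqP/symbol_eq0 h.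
  have [|b' Jb' hb] := reg2 Ja Jb.
    by apply: h; apply: ideal_powB; apply: (ideal_pow_mul (u := 1)).
  (* For [u = 0] the predecessor is truncated and [b'] has no symbol of degree -1; but then [a]
     itself lies in [J], so its symbol vanishes and 0 serves as quotient. *)
  case: u Ja Jb h Jb' hb => [|u] Ja Jb h Jb' hb.
    exists 0; rewrite mulr0; apply/symbol_eq0 => //.
    rewrite -[a](subrK (t1 * b')); apply: ideal_powD => //.
    exact: (ideal_pow_mul (u := 1) (v := 0)).
  have Jtb : Jpow u.+1 (t1 * b') by exact: (ideal_pow_mul (u := 1)).
  exists (symbol J u b'); rewrite -symbolM //.
  apply/eqP; rewrite -subr_eq0 -symbolB //; apply/eqP/symbol_eq0 => //.
  exact: ideal_powB.
- move=> c _ _ Gc /symbolP [a _ ->] /symbolP [b _ ->].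
  have /boolp.choice [d hd] : forall j, exists d, c 0 j = symbol J 0 d.
    by move=> j; have /symbolP [d _ ->] := Gc j; exists d.
  rewrite mxE; under eq_bigr => j _.
    rewrite mxE hd -symbolM //; over.
  have Jdz j : Jpow 1 (d j * z j) by exact: (ideal_pow_mul (u := 0) (v := 1)).
  have Jta t e : Jpow 1 t -> Jpow 1 (t * e).
    by move=> Jt; exact: (ideal_pow_mul (u := 1) (v := 0)).
  rewrite -symbol_sum // -!symbolM // -symbolD; try exact: Jta.
  have Js : Jpow 1 (\sum_i d i * z i) by exact: ideal_pow_sum.
  have Jt : Jpow 1 (t1 * a + t2 * b) by apply: ideal_powD; apply: Jta.
  move=> /eqP; rewrite -subr_eq0 -symbolB // => /eqP/symbol_eq0 h.
  apply/matrixP => i j; rewrite ord1 hd mxE; apply/symbol_eq0 => //.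
  apply: ideal_pow1P; apply: indep; apply: h.
  exact: ideal_powB.
Qed.

End AssociatedGradedCriterion.

(** * Exponents of monomials in the weighted rational curve *)

Section Exponents.
Local Open Scope nat_scope.
Variables (d e : nat) (hd : 0 < d) (he : 0 < e).
Implicit Types (u v p q a b : nat).

(* s^p t^q lies in m^u. *)
Definition order_ge u p q : Prop :=
  exists a b, [/\ p + q = d * (a + e * b), a <= p & u <= a + b].

Lemma order_geM u v p q p' q' :
  order_ge u p q -> order_ge v p' q' -> order_ge (u + v) (p + p') (q + q').
Proof.
move=> [a [b [h1 h2 h3]]] [a' [b' [h1' h2' h3']]].
by exists (a + a'), (b + b'); split; nia.
Qed.

Lemma order_ge_le u v p q : u <= v -> order_ge v p q -> order_ge u p q.
Proof. by move=> le [a [b [h1 h2 h3]]]; exists a, b; split; lia. Qed.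

Lemma order_ge1 p q : order_ge 0 p q -> 0 < p + q -> order_ge 1 p q.
Proof.
move=> [[|a] [[|b] [h1 h2 h3]]] pos; last 3 first.
- by exists 0, b.+1.
- by exists a.+1, 0.
- by exists a.+1, b.+1.
by rewrite h1 muln0 add0n muln0 in pos.
Qed.

(* If a = 0, trade one y for e of the x's. *)
Lemma order_ge_trade u p q : order_ge u p q -> 0 < u -> e <= p ->
  exists a b, [/\ p + q = d * (a + e * b), 0 < a <= p & u <= a + b].
Proof.
move=> [[|a] [b [h1 h2 h3]]] upos le; last by exists a.+1, b; split; lia.
by case: b h1 h3 => [|b] h1 h3; [lia | exists e, b; split; nia].
Qed.

(* s^p t^q lies in x_(d-1) m^u, where x_(d-1) = s t^(d-1). *)
Definition th1_multiple u p q : Prop :=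
  [/\ 0 < p, d.-1 <= q & order_ge u p.-1 (q - d.-1)].

Lemma th1_multiple_intro u p q a b :
  p + q = d * (a + e * b) -> 0 < a <= p -> u < a + b -> d.-1 <= q ->
  th1_multiple u p q.
Proof.
move=> h1 h2 h3 h4; split; [lia | lia | exists a.-1, b; split; nia].
Qed.

(** An x can be split off whenever some factorization has a > 0, which a trade ensures for p >= e.
    Otherwise p < e and a y absorbs all of s^p. *)
Lemma order_ge_split u p q : order_ge u.+1 p q ->
  (exists2 i, i < d &
    [/\ d - i <= p, i <= q & order_ge u (p - (d - i)) (q - i)])
  \/ (exists2 i, i < e & [/\ e - 1 - i <= p, e * d - (e - 1) + i <= q &
        order_ge u (p - (e - 1 - i)) (q - (e * d - (e - 1) + i))]).
Proof.
have X a b : p + q = d * (a + e * b) -> 0 < a <= p -> u < a + b ->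
  (exists2 i, i < d &
    [/\ d - i <= p, i <= q & order_ge u (p - (d - i)) (q - i)]).
  move=> h1 h2 h3; have [le|lt] := leqP d.-1 q.
    exists d.-1; first lia; split; [lia | lia |].
    exists a.-1, b; split; nia.
  (* There are too few factors t for x_(d-1), so x_q takes all of them and leaves a pure power of
     s. *)
  have le : a.-1 + (d - q) <= p by nia.
  exists q; first lia; split; [lia | lia |].
  by exists a.-1, b; split; nia.
move=> h; have [le|lt] := leqP e p.
  have [a [b [h1 h2 h3]]] := order_ge_trade h isT le.
  by left; apply: X h1 h2 h3.
case: h => -[|a] [b [h1 h2 h3]]; last by left; apply: (X a.+1 b).
right; exists (e - 1 - p); first lia.
have le1 : e - 1 <= e * d by nia.
have le2 : e * d <= p + q by nia.
split; [lia | lia |]; exists 0, b.-1; split; nia.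
Qed.

(** The degree determines the number of x's in a factorization modulo [e]; this is how two
    factorizations are compared. *)
Lemma mul_add_remainder r b b' : r < e -> e * b = r + e * b' -> r = 0.
Proof.
move=> lt; have [le|lt'] := leqP b b'.
  by have := leq_mul (leqnn e) le; lia.
by have := leq_mul (leqnn e) lt'; rewrite mulnS; lia.
Qed.

(** If the factorization of the product contains an x, one x is removed. If it has only y's, one y
    becomes e - 1 of the x's when p >= e - 1; for smaller p, a0 + 1 < e would be divisible by e. *)
Lemma order_ge_reg1 u p q :
  order_ge 0 p q -> order_ge u.+2 p.+1 (q + d.-1) -> order_ge u.+1 p q.
Proof.
move=> [a0 [b0 [h1 h2 _]]] [[|a] [b [h1' h2' h3']]]; last first.
  by exists a, b; split; nia.
have e1 : a0 + e * b0 + 1 = e * b by nia.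
have [le|lt] := leqP e.-1 p; first by exists e.-1, b.-1; split; nia.
have := @mul_add_remainder a0.+1 b b0; lia.
Qed.

(* One of the two terms x_0 = s^d and y_(e-1) = t^(ed) of th2 keeps the       *)
(* monomial nonzero modulo th1 in the associated graded ring, and the other   *)
(* term cannot produce the same monomial from another element of R.           *)
Lemma order_ge_reg2 u p q :
  order_ge u p q -> ~ order_ge u.+1 p q -> ~ th1_multiple u.-1 p q ->
  [/\ q < e * d, ~ order_ge u.+2 (p + d) q & ~ th1_multiple u (p + d) q] \/
  [/\ p < d \/ ~ order_ge 0 (p - d) (q + e * d),
      ~ order_ge u.+2 p (q + e * d) & ~ th1_multiple u p (q + e * d)].
Proof.
move=> hS h1 hT; have [le|lt] := leqP d.-1 q; last first.
  left; split; [nia | | by move=> [_ lt' _]; lia].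
  move=> [[|a] [b [k1 k2 k3]]].
    case: b k1 k3 => [|[|b]] k1 k3 //.
    (* One y is traded for e of the x's, one of which is the added x_0; this leaves e - 1 of them
       for the original monomial. *)
    have le : e.-1 <= d * e.-1 by rewrite leq_pmull.
    apply: h1; exists e.-1, b.+1; split; [nia | nia | lia].
  by apply: h1; exists a, b; split; nia.
right.
(* Since q >= d - 1, any x in a factorization could be taken to be x_(d-1), against [hT]; so only
   y's occur, and p < e since otherwise a y could be traded. *)
have [p_lt [b [e1 e2]]] : p < e /\ exists b, p + q = d * (e * b) /\ u <= b.
  have X a b : p + q = d * (a + e * b) -> 0 < a <= p -> u <= a + b -> False.
    move=> k1 k2 k3; apply: hT; split; [lia | lia |].
    by exists a.-1, b; split; nia.
  case: hS => -[|a] [b [k1 k2 k3]]; last by case: (X a.+1 b).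
  split; last by exists b; split; lia.
  rewrite ltnNge; apply/negP => le'.
  by case: b k1 k3 => [|b] k1 k3; [nia | case: (X e b); nia].
split.
- have [?|dp] := ltnP p d; [by left | right].
  move=> [a' [b' [k1 k2 k3]]].
  have k : e * b + e = a' + e * b' + 1 by nia.
  have := @mul_add_remainder a'.+1 b.+1 b'; lia.
- move=> [a' [b' [k1 k2 k3]]].
  have k : e * b + e = a' + e * b' by nia.
  have a0 : a' = 0 by apply: (@mul_add_remainder a' b.+1 b'); lia.
  by apply: h1; exists 0, b; split; nia.
- move=> [k1 k2 [a' [b' [k3 k4 k5]]]].
  have k : e * b + e = a' + e * b' + 1 by nia.
  have := @mul_add_remainder a'.+1 b.+1 b'; lia.
Qed.

(** In the last two cases the monomial is x_0 n or y_(e-1) n with n in m, and the other term of th2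
    n lies in th1 m; the monomial is therefore th2 n minus an element of th1 m. *)
Lemma order_ge_quad p q : order_ge 2 p q ->
  [\/ th1_multiple 1 p q,
      [/\ d <= p, order_ge 1 (p - d) q & th1_multiple 1 (p - d) (q + e * d)]
    | [/\ e * d <= q, order_ge 1 p (q - e * d) &
          th1_multiple 1 (p + d) (q - e * d)]].
Proof.
have X a b : p + q = d * (a + e * b) -> 0 < a <= p -> 1 < a + b ->
  th1_multiple 1 p q \/
  [/\ d <= p, order_ge 1 (p - d) q & th1_multiple 1 (p - d) (q + e * d)].
  move=> h1 h2 h3; have [le|lt] := leqP d.-1 q.
    by left; apply: (th1_multiple_intro (a := a) (b := b)).
  have le : d + a.-1 <= p.
    case: a h1 h2 h3 => [//|[|a]] h1 h2 h3.
      have : d <= d * (e * b) by rewrite leq_pmulr // muln_gt0 he.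
      lia.
    have : a <= d * a by rewrite leq_pmull.
    nia.
  right; split; [lia | by exists a.-1, b; split; nia |].
  (* Replacing x_0 by y_(e-1) gives the pair (a - 1, b + 1). For a = 1 no x remains, so one y is
     traded for e of the x's before x_(d-1) is split off. *)
  case: a h1 h2 h3 le => [//|[|a]] h1 h2 h3 le.
    have l1 : d * e <= d * (e * b) by rewrite leq_mul2l leq_pmulr ?orbT.
    have l2 : e.-1 <= d * e.-1 by rewrite leq_pmull.
    have l3 : d <= e * d by rewrite leq_pmull.
    apply: (th1_multiple_intro (a := e) (b := b)); [nia | nia | lia | lia].
  apply: (th1_multiple_intro (a := a.+1) (b := b.+1)); nia.
move=> h; have [le|lt] := leqP e p.
  have [a [b [h1 h2 h3]]] := order_ge_trade h isT le.
  by case: (X a b h1 h2 h3) => ?; [apply: Or31 | apply: Or32].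
case: h => -[|a] [b [h1 h2 h3]].
  apply: Or33; have le : e * d <= q by nia.
  split; [by [] | by exists 0, b.-1; split; nia |].
  by apply: (th1_multiple_intro (a := 1) (b := b.-1)); nia.
by case: (X a.+1 b h1) => // ?; [apply: Or31 | apply: Or32].
Qed.

Lemma order_ge2_x i : i < d -> ~ order_ge 2 (d - i) i.
Proof.
move=> lt [a [b [h1 h2 h3]]].
have lb : b <= e * b by rewrite leq_pmull.
have : d * 2 <= d * (a + e * b) by rewrite leq_mul2l; lia.
lia.
Qed.

Lemma order_ge2_y i : i < e -> ~ order_ge 2 (e - 1 - i) (e * d - (e - 1) + i).
Proof.
move=> lt [a [b [h1 h2 h3]]].
have le : e - 1 <= e * d by nia.
have e1 : e = a + e * b by nia.
by case: b h1 h3 e1 => [|[|b]]; nia.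
Qed.

Lemma order_ge1_x i : i < d -> order_ge 1 (d - i) i.
Proof. by move=> lt; exists 1, 0; split; nia. Qed.

Lemma order_ge1_y i : i < e -> order_ge 1 (e - 1 - i) (e * d - (e - 1) + i).
Proof. by move=> lt; exists 0, 1; split; nia. Qed.

End Exponents.

(** * Powers of the maximal ideal *)

Section Support.
Variables (k : fieldType) (n : nat).
Implicit Types (f g : {mpoly k[n]}) (m : 'X_{1..n}).

Definition supp_in (P : 'X_{1..n} -> Prop) f : Prop :=
  forall m, f@_m != 0 -> P m.

Lemma supp_in_sum (P : 'X_{1..n} -> Prop) (I : Type) (r : seq I)
    (Q : pred I) F :
  (forall i, Q i -> supp_in P (F i)) -> supp_in P (\sum_(i <- r | Q i) F i).
Proof.
move=> h; apply: big_ind => // [m|f g hf hg m]; first by rewrite mcoeff0 eqxx.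
rewrite mcoeffD => nz; have [f0|fn] := eqVneq (f@_m) 0; last exact: hf.
by apply: hg; rewrite f0 add0r in nz.
Qed.

Lemma mcoeffM_neq0 f g m : (f * g)@_m != 0 ->
  exists m1 m2, [/\ m = (m1 + m2)%MM, f@_m1 != 0 & g@_m2 != 0].
Proof.
rewrite mpolyME => /(@supp_in_sum (fun m => exists m1 m2,
   [/\ m = (m1 + m2)%MM, f@_m1 != 0 & g@_m2 != 0])); apply=> -[m1 m2] _.
move=> m'; rewrite mcoeffZ mcoeffX /=.
case: (_ =P m') => [<-|_]; last by rewrite mulr0 eqxx.
rewrite mulr1 mulf_eq0 negb_or => /andP [n1 n2].
by exists m1, m2.
Qed.

Lemma mcoeffMX_neq0 f (g m : 'X_{1..n}) : (f * 'X_[g])@_m != 0 ->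
  exists2 m', m = (m' + g)%MM & f@_m' != 0.
Proof.
move=> /mcoeffM_neq0 [m1 [m2 [-> h]]]; rewrite mcoeffX.
by case: (_ =P m2) => [->|_]; [exists m1 | rewrite eqxx].
Qed.

End Support.

Definition mono (p q : nat) : 'X_{1..2} :=
  (U_(ord0) *+ p + U_(ord_max) *+ q)%MM.

Lemma mono0 p q : mono p q ord0 = p.
Proof. by rewrite mnmDE !mulmnE !mnm1E /= mul1n mul0n addn0. Qed.

Lemma mono1 p q : mono p q ord_max = q.
Proof. by rewrite mnmDE !mulmnE !mnm1E /= mul1n mul0n. Qed.

Lemma mono_eta (m : 'X_{1..2}) : m = mono (m ord0) (m ord_max).
Proof.
apply/mnmP => -[[|[|//]] lt].
  by rewrite (_ : Ordinal lt = ord0) ?mono0 //; apply: val_inj.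
by rewrite (_ : Ordinal lt = ord_max) ?mono1 //; apply: val_inj.
Qed.

Lemma monoD p q p' q' : (mono p q + mono p' q')%MM = mono (p + p') (q + q').
Proof. by rewrite [LHS]mono_eta (mnmDE ord0) (mnmDE ord_max) !mono0 !mono1. Qed.

Lemma mono_inj p q p' q' : mono p q = mono p' q' -> p = p' /\ q = q'.
Proof.
move=> h; split.
  by have := congr1 (fun m : 'X_{1..2} => m ord0) h; rewrite !mono0.
by have := congr1 (fun m : 'X_{1..2} => m ord_max) h; rewrite !mono1.
Qed.

Section Curve.
Variables (k : fieldType) (d e : nat) (hd : (0 < d)%N) (he : (0 < e)%N).

Let R := wrc_ring k d e.
Let J := wrc_max_ideal k hd he.
Notation Jpow := (ideal_pow J).

(** The embedding of R in k[s,t] induced by phi; [wrc_evalE] shows that the representative does not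
    matter. *)
Definition wrc_eval (x : R) : {mpoly k[2]} := wrc_phi (repr x).

Lemma wrc_evalE p : wrc_eval (\pi_{ideal_quot (@wrc_ker k d e)} p) = wrc_phi p.
Proof.
apply/eqP; rewrite -subr_eq0 /wrc_eval /wrc_phi -comp_mpolyB.
have := reprK (\pi_{ideal_quot (@wrc_ker k d e)} p); move/eqP.
by rewrite -Quotient.idealrBE.
Qed.

Lemma wrc_evalD x y : wrc_eval (x + y) = wrc_eval x + wrc_eval y.
Proof.
rewrite -[x]reprK -[y]reprK -rmorphD !wrc_evalE /wrc_phi.
exact: comp_mpolyD.
Qed.

Lemma wrc_evalM x y : wrc_eval (x * y) = wrc_eval x * wrc_eval y.
Proof. by rewrite -[x]reprK -[y]reprK -rmorphM !wrc_evalE /wrc_phi rmorphM. Qed.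

Lemma wrc_evalC c : wrc_eval (\pi_{ideal_quot (@wrc_ker k d e)} c%:MP) = c%:MP.
Proof. by rewrite wrc_evalE /wrc_phi comp_mpolyC. Qed.

Lemma wrc_eval1 : wrc_eval 1 = 1.
Proof.
rewrite -[1](rmorph1 \pi_{ideal_quot (@wrc_ker k d e)}) wrc_evalE /wrc_phi.
exact: comp_mpoly1.
Qed.

Lemma wrc_eval0 : wrc_eval 0 = 0.
Proof. by apply: (addIr (wrc_eval 0)); rewrite -wrc_evalD !add0r. Qed.

Lemma wrc_evalB x y : wrc_eval (x - y) = wrc_eval x - wrc_eval y.
Proof. by apply/eqP; rewrite -subr_eq opprK -wrc_evalD subrK. Qed.

Lemma wrc_eval_sum (I : Type) (r : seq I) (F : I -> R) :
  wrc_eval (\sum_(i <- r) F i) = \sum_(i <- r) wrc_eval (F i).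
Proof.
by elim/big_rec2: _ => [|i y x _ <-]; [exact: wrc_eval0 | exact: wrc_evalD].
Qed.

Lemma wrc_eval_inj : injective wrc_eval.
Proof.
move=> x y /eqP; rewrite -subr_eq0 /wrc_eval /wrc_phi -comp_mpolyB => h.
rewrite -[x]reprK -[y]reprK; apply/eqP; rewrite -Quotient.idealrBE.
exact: h.
Qed.

Definition gen_mono (j : 'I_(d + e)) : 'X_{1..2} :=
  match split j with
  | inl i => mono (d - i) i
  | inr i => mono (e - 1 - i) (e * d - (e - 1) + i)
  end.

Lemma gen_mono_x i : gen_mono (lshift e i) = mono (d - i) i.
Proof. by rewrite /gen_mono -[lshift e i]/(unsplit (inl i)) unsplitK. Qed.

Lemma gen_mono_y i :
  gen_mono (rshift d i) = mono (e - 1 - i) (e * d - (e - 1) + i).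
Proof. by rewrite /gen_mono -[rshift d i]/(unsplit (inr i)) unsplitK. Qed.

Lemma wrc_eval_gen j : wrc_eval (wrc_gen k j) = 'X_[gen_mono j].
Proof.
rewrite /wrc_gen wrc_evalE /wrc_phi comp_mpolyXU -tnth_nth tnth_mktuple.
rewrite /wrc_mono /gen_mono.
by case: (split j) => i; rewrite /mono mpolyXD -!mpolyXn.
Qed.

Lemma gen_mono_inj : injective gen_mono.
Proof.
move=> j1 j2; rewrite -[j1]splitK -[j2]splitK.
case: (split j1) => i1; case: (split j2) => i2;
  rewrite /= ?gen_mono_x ?gen_mono_y => /mono_inj [h1 h2].
- by congr lshift; apply: val_inj.
- have := ltn_ord i1; have := ltn_ord i2; nia.
- have := ltn_ord i1; have := ltn_ord i2; nia.
- by congr rshift; apply: val_inj => /=; lia.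
Qed.

Definition ord_ge u (m : 'X_{1..2}) : Prop :=
  order_ge d e u (m ord0) (m ord_max).

Lemma ord_ge_mono u p q : ord_ge u (mono p q) = order_ge d e u p q.
Proof. by rewrite /ord_ge mono0 mono1. Qed.

Lemma ord_geM u v m m' :
  ord_ge u m -> ord_ge v m' -> ord_ge (u + v) (m + m')%MM.
Proof. by rewrite /ord_ge !mnmDE; apply: order_geM. Qed.

Lemma ord_ge_gen j : ord_ge 1 (gen_mono j).
Proof.
rewrite -[j]splitK.
case: (split j) => i /=; rewrite ?gen_mono_x ?gen_mono_y ord_ge_mono.
  exact: order_ge1_x.
exact: order_ge1_y.
Qed.

Lemma ord_ge_gen2 j : ~ ord_ge 2 (gen_mono j).
Proof.
rewrite -[j]splitK.
case: (split j) => i /=; rewrite ?gen_mono_x ?gen_mono_y ord_ge_mono.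
  exact: order_ge2_x.
exact: order_ge2_y.
Qed.

Lemma supp_ordM u v (f g : {mpoly k[2]}) :
  supp_in (ord_ge u) f -> supp_in (ord_ge v) g ->
  supp_in (ord_ge (u + v)) (f * g).
Proof.
by move=> hf hg m /mcoeffM_neq0 [m1 [m2 [-> /hf h1 /hg h2]]]; apply: ord_geM.
Qed.

Lemma supp_ord0 (x : R) : supp_in (ord_ge 0) (wrc_eval x).
Proof.
have supp0C c : supp_in (ord_ge 0) (c%:MP_[2] : {mpoly k[2]}).
  move=> m; rewrite mcoeffC.
  case: (m =P _) => [-> _|_]; last by rewrite mulr0 eqxx.
  by rewrite /ord_ge !mnm0E; exists 0%N, 0%N; split; lia.
rewrite /wrc_eval /wrc_phi comp_mpolyE; apply: supp_in_sum => m _.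
rewrite -mul_mpolyC; apply: (supp_ordM (u := 0) (v := 0)) => //.
apply: big_ind => [|f g|j _]; first exact: (supp0C 1).
  exact: (supp_ordM (u := 0) (v := 0)).
rewrite tnth_mktuple; elim: (m j) => [|i IH]; first exact: (supp0C 1).
rewrite exprS; apply: (supp_ordM (u := 0) (v := 0)) => //.
have <- : 'X_[gen_mono j] = wrc_mono k j.
  rewrite -wrc_eval_gen /wrc_gen wrc_evalE /wrc_phi comp_mpolyXU -tnth_nth.
  exact: tnth_mktuple.
move=> m'; rewrite mcoeffX; case: (_ =P m') => [<- _|_]; last by rewrite eqxx.
exact: order_ge_le (ord_ge_gen j).
Qed.

Lemma wrc_maxP (x : R) :
  reflect (exists c : 'I_(d + e) -> R, x = \sum_j c j * wrc_gen k j) (x \in J).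
Proof. exact: boolp.asboolP. Qed.

Lemma wrc_gen_max j : wrc_gen k j \in J.
Proof.
apply/wrc_maxP; exists (fun i => (i == j)%:R).
rewrite (bigD1 j) //= eqxx mul1r big1 ?addr0 //.
by move=> i /negbTE ->; rewrite mul0r.
Qed.

Lemma Jpow_supp u (x : R) : Jpow u x -> supp_in (ord_ge u) (wrc_eval x).
Proof.
elim: u x => [|u IH] x; first by move=> _; apply: supp_ord0.
move=> [n [f [g [Jf Jg ->]]]]; rewrite wrc_eval_sum; apply: supp_in_sum => i _.
rewrite wrc_evalM; apply: (supp_ordM (u := 1)); last exact/IH/Jg.
have /wrc_maxP [c ->] := Jf i; rewrite wrc_eval_sum; apply: supp_in_sum => j _.
rewrite wrc_evalM wrc_eval_gen.
apply: (supp_ordM (u := 0) (v := 1)); first exact: supp_ord0.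
move=> m'; rewrite mcoeffX; case: (_ =P m') => [<- _|_]; last by rewrite eqxx.
exact: ord_ge_gen.
Qed.

Lemma mono_lift u p q : order_ge d e u p q ->
  exists2 r, Jpow u r & wrc_eval r = 'X_[mono p q].
Proof.
have [n le] := ubnP (p + q); elim: n u p q le => // n IH u p q le h.
have [z|pos] := posnP (p + q).
  have [-> ->] : p = 0%N /\ q = 0%N by lia.
  have -> : u = 0%N.
    case: h => a [b [h1 h2 h3]]; case: b h1 h3 => [|b]; nia.
  exists 1 => //; rewrite wrc_eval1 -mpolyX0; congr 'X_[_].
  by rewrite [LHS]mono_eta !mnm0E.
(* Even for [u = 0] a nonconstant monomial of R has order at least 1, so a generator can be split
   off. *)
have [v leuv] : exists2 v, (u <= v.+1)%N & order_ge d e v.+1 p q.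
  by case: u h => [|u] h; [exists 0%N => //; apply: order_ge1 | exists u].
have lift j p' q' : gen_mono j = mono p' q' -> (0 < p' + q')%N ->
    (p' <= p)%N -> (q' <= q)%N -> order_ge d e v (p - p') (q - q') ->
    exists2 r, Jpow u r & wrc_eval r = 'X_[mono p q].
  move=> ej pos' lp lq h'.
  have [|r Jr er] := IH v (p - p')%N (q - q')%N _ h'; first by lia.
  exists (wrc_gen k j * r).
    apply: (ideal_pow_le leuv).
    exact: (ideal_pow_mul (u := 1) (ideal_pow1P (wrc_gen_max j)) Jr).
  by rewrite wrc_evalM wrc_eval_gen er -mpolyXD ej monoD !subnKC.
case/(order_ge_split hd he) => -[i lt [lp lq h']].
  by apply: (lift (lshift e (Ordinal lt))) h' => //; [rewrite gen_mono_x | lia].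
apply: (lift (rshift d (Ordinal lt))) h' => //; first by rewrite gen_mono_y.
have : (e <= e * d)%N by rewrite leq_pmulr.
lia.
Qed.

(** Membership in an ideal of R can be tested on monomials: scalars of k lift to R, and injectivity
    of [wrc_eval] identifies [x] with the combination of the lifted monomials. *)
Lemma span_lift (W : R -> Prop) x :
  W 0 -> (forall y z, W y -> W z -> W (y + z)) ->
  (forall c y, W y -> W (c * y)) ->
  (forall m, (wrc_eval x)@_m != 0 ->
    exists2 r, W r & wrc_eval r = 'X_[m]) ->
  W x.
Proof.
move=> W0 WD WM hx.
have /boolp.choice [r hr] : forall m, exists r, (wrc_eval x)@_m != 0 ->
    W r /\ wrc_eval r = 'X_[m].
  move=> m; have [z|nz] := eqVneq (wrc_eval x)@_m 0; first by exists 0.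
  by have [r] := hx m nz; exists r.
have -> : x = \sum_(m <- msupp (wrc_eval x))
    \pi_{ideal_quot (@wrc_ker k d e)} ((wrc_eval x)@_m)%:MP * r m.
  apply: wrc_eval_inj; rewrite wrc_eval_sum [LHS]mpolyE big_seq [RHS]big_seq.
  apply: eq_bigr => m; rewrite mcoeff_msupp => /hr [_ e'].
  by rewrite wrc_evalM wrc_evalC e' mul_mpolyC.
rewrite big_seq; apply: big_ind => // m; rewrite mcoeff_msupp => /hr [Wr _].
exact: WM.
Qed.

Lemma supp_Jpow u x : supp_in (ord_ge u) (wrc_eval x) -> Jpow u x.
Proof.
move=> h; apply: span_lift.
- exact: ideal_pow0.
- exact: ideal_powD.
- exact: ideal_powM.
by move=> m /h /mono_lift [r Jr er]; exists r; rewrite // er -mono_eta.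
Qed.


(** * The linear forms th1, th2 and the hypotheses of the criterion for the curve *)

Let x0 : 'I_(d + e) := lshift e (Ordinal hd).
Let last_x : 'I_(d + e) := lshift e (Ordinal (etrans (ltn_predL d) hd)).
Let last_y : 'I_(d + e) := rshift d (Ordinal (etrans (ltn_predL e) he)).

Let t1 : R := wrc_gen k last_x.
Let t2 : R := wrc_gen k x0 + wrc_gen k last_y.

Let gen_mono_x0 : gen_mono x0 = mono d 0.
Proof. by rewrite gen_mono_x subn0. Qed.

Let gen_mono_last_x : gen_mono last_x = mono 1 d.-1.
Proof. by rewrite gen_mono_x /=; congr mono; lia. Qed.

Let gen_mono_last_y : gen_mono last_y = mono 0 (e * d).
Proof.
rewrite gen_mono_y /=; have : (e <= e * d)%N by rewrite leq_pmulr.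
by move=> le; congr mono; lia.
Qed.

Let t1M x : wrc_eval (t1 * x) = wrc_eval x * 'X_[mono 1 d.-1].
Proof. by rewrite wrc_evalM wrc_eval_gen gen_mono_last_x mulrC. Qed.

Let t2M x : wrc_eval (t2 * x) =
  wrc_eval x * 'X_[mono d 0] + wrc_eval x * 'X_[mono 0 (e * d)].
Proof.
rewrite wrc_evalM wrc_evalD !wrc_eval_gen gen_mono_x0 gen_mono_last_y.
by rewrite mulrDl ![_ * wrc_eval x]mulrC.
Qed.

Lemma th1_multiple_lift u p q : th1_multiple d e u p q ->
  exists2 r, Jpow u r & wrc_eval (t1 * r) = 'X_[mono p q].
Proof.
move=> [h1 h2 /mono_lift [r Jr er]]; exists r; rewrite // t1M er -mpolyXD monoD.
by congr 'X_[mono _ _]; lia.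
Qed.

Lemma th1_multiple_coef u x p q : Jpow u x ->
  (wrc_eval (t1 * x))@_(mono p q) != 0 -> th1_multiple d e u p q.
Proof.
move=> Jx; rewrite t1M => /mcoeffMX_neq0 [m em /(Jpow_supp Jx)].
rewrite (mono_eta m) ord_ge_mono; move: em; rewrite {1}(mono_eta m) monoD.
move=> /mono_inj [-> ->] h; split; [lia | lia |].
by rewrite addn1 addnK.
Qed.

Lemma wrc_max_quad x : Jpow 2 x ->
  exists ab : R * R, [/\ ab.1 \in J, ab.2 \in J & x = t1 * ab.1 + t2 * ab.2].
Proof.
move=> /Jpow_supp hx; pose W x :=
  exists ab : R * R, [/\ ab.1 \in J, ab.2 \in J & x = t1 * ab.1 + t2 * ab.2].
apply: (@span_lift W).
- by exists (0, 0); rewrite !rpred0 !mulr0 addr0.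
- move=> y z [[a b] [Ja Jb ->]] [[a' b'] [Ja' Jb' ->]].
  exists (a + a', b + b'); split; [exact: rpredD | exact: rpredD |] => /=.
  by ring.
- move=> c y [[a b] [Ja Jb ->]]; exists (c * a, c * b).
  by split; [exact: idealMr | exact: idealMr | rewrite /=; ring].
move=> m /hx; rewrite (mono_eta m) ord_ge_mono.
move: (m ord0) (m ord_max) => p q.
have J1 r : Jpow 1 r -> r \in J by apply: ideal_pow1.
case/(order_ge_quad hd he) =>
  [/th1_multiple_lift [r /J1 Jr er]|[l h1 h2]|[l h1 h2]].
- exists (t1 * r) => //; exists (r, 0); split=> //; first exact: rpred0.
  by rewrite mulr0 addr0.
- have [r /J1 Jr er] := mono_lift h1.
  have [r' /J1 Jr' er'] := th1_multiple_lift h2.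
  exists (t1 * (- r') + t2 * r).
    by exists (- r', r); split=> //; rewrite rpredN.
  rewrite mulrN addrC wrc_evalB t2M er er' -!mpolyXD !monoD !addn0 subnK //.
  by rewrite addrK.
have [r /J1 Jr er] := mono_lift h1.
have [r' /J1 Jr' er'] := th1_multiple_lift h2.
exists (t1 * (- r') + t2 * r).
  by exists (- r', r); split=> //; rewrite rpredN.
rewrite mulrN addrC wrc_evalB t2M er er' -!mpolyXD !monoD !addn0 subnK //.
by rewrite addrAC subrr add0r.
Qed.

Lemma wrc_max_reg1 u x : Jpow u x -> Jpow u.+2 (t1 * x) -> Jpow u.+1 x.
Proof.
move=> _ /Jpow_supp h; apply: supp_Jpow => m nz.
have := h (mono 1 d.-1 + m)%MM; rewrite t1M mcoeffMX => /(_ nz).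
have := supp_ord0 nz; rewrite (mono_eta m) monoD !ord_ge_mono add1n addnC.
exact: order_ge_reg1.
Qed.

(** Each monomial of [x] lies in th1 m^(u-1) + m^(u+1). Otherwise [order_ge_reg2] selects a term of
    th2 whose product with it can neither be cancelled by th1 y nor belong to m^(u+2), nor come from
    another monomial of [x]. *)
Lemma wrc_max_reg2 u x y :
  Jpow u x -> Jpow u y -> Jpow u.+2 (t2 * x - t1 * y) ->
  exists2 z, Jpow u.-1 z & Jpow u.+1 (x - t1 * z).
Proof.
move=> Jx Jy /Jpow_supp h.
apply: (@span_lift (fun x => exists2 z, Jpow u.-1 z & Jpow u.+1 (x - t1 * z))).
- by exists 0; [exact: ideal_pow0 | rewrite mulr0 subrr; exact: ideal_pow0].
- move=> z1 z2 [b1 J1 h1] [b2 J2 h2]; exists (b1 + b2); first exact: ideal_powD.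
  have -> : z1 + z2 - t1 * (b1 + b2) = (z1 - t1 * b1) + (z2 - t1 * b2) by ring.
  exact: ideal_powD.
- move=> c z [b Jb hb]; exists (c * b); first exact: ideal_powM.
  have -> : c * z - t1 * (c * b) = c * (z - t1 * b) by ring.
  exact: ideal_powM.
move=> m nz; rewrite (mono_eta m).
have hm := Jpow_supp Jx nz; rewrite (mono_eta m) ord_ge_mono in hm nz.
move: (m ord0) (m ord_max) hm nz => p q {m} hm nz.
have [h1|n1] := boolp.EM (order_ge d e u.+1 p q).
  have [r Jr er] := mono_lift h1.
  exists r => //; exists 0; first exact: ideal_pow0.
  by rewrite mulr0 subr0.
have [h1|n2] := boolp.EM (th1_multiple d e u.-1 p q).
  have [r Jr er] := th1_multiple_lift h1; exists (t1 * r) => //; exists r => //.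
  by rewrite subrr; apply: ideal_pow0.
(* Here th2 x is read as the sum of th2 x - th1 y, supported in m^(u+2), and th1 y, supported in th1
   m^u. *)
have coef0 p' q' : ~ order_ge d e u.+2 p' q' -> ~ th1_multiple d e u p' q' ->
    (wrc_eval (t2 * x))@_(mono p' q') = 0.
  move=> k1 k2; have c1 : (wrc_eval (t1 * y))@_(mono p' q') = 0.
    by apply/eqP/negPn/negP => /(th1_multiple_coef Jy).
  apply/eqP/negPn/negP => c2; apply: k1; have := h (mono p' q').
  by rewrite ord_ge_mono wrc_evalB mcoeffB c1 subr0; apply.
have coefM (f : {mpoly k[2]}) p' q' :
    (f * 'X_[mono p' q'])@_(mono (p + p') (q + q')) = f@_(mono p q).
  by rewrite -monoD addmC mcoeffMX.
have := order_ge_reg2 hd he hm n1 n2.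
case=> -[k1 k2 k3]; move: nz.
- have := coef0 _ _ k2 k3; rewrite t2M mcoeffD.
  rewrite -[q in (_ * 'X_[mono d 0])@_(mono _ q)]addn0 coefM.
  have [->|] := eqVneq ((wrc_eval x * 'X_[mono 0 (e * d)])@_(mono (p + d) q)) 0.
    by rewrite addr0 => ->; rewrite eqxx.
  by move=> /mcoeffMX_neq0 [m + _]; rewrite (mono_eta m) monoD => /mono_inj; lia.
- have := coef0 _ _ k2 k3; rewrite t2M mcoeffD.
  rewrite -[p in (_ * 'X_[mono 0 _])@_(mono p _)]addn0 coefM.
  have [->|] := eqVneq ((wrc_eval x * 'X_[mono d 0])@_(mono p (q + e * d))) 0.
    by rewrite add0r => ->; rewrite eqxx.
  move=> /mcoeffMX_neq0 [m + /supp_ord0]; rewrite (mono_eta m) monoD ord_ge_mono.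
  move=> /mono_inj [e1 e2] hm0; case: k1 => [|[]]; first by lia.
  by rewrite e1 e2 addnK addn0.
Qed.

Let c0 (x : R) : k := (wrc_eval x)@_0.

Let c0_max x : c0 x = 0 -> x \in J.
Proof.
move=> h; apply: ideal_pow1; apply: supp_Jpow => m nz.
apply: order_ge1; first exact: (supp_ord0 nz).
rewrite lt0n; apply: contraNN nz => z.
apply/eqP; rewrite -[RHS]h /c0; congr (_@__).
by rewrite (mono_eta m) [RHS]mono_eta !mnm0E; congr mono; lia.
Qed.

(** The generators are distinct monomials outside m^2, so only the constant term of [x] can
    contribute. *)
Let coef_gen x i j :
  (wrc_eval (x * wrc_gen k i))@_(gen_mono j) = c0 x *+ (i == j).
Proof.
rewrite wrc_evalM wrc_eval_gen; case: eqVneq => [->|ne].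
  by have := mcoeffMX (wrc_eval x) (gen_mono j) 0; rewrite addm0.
apply/eqP; rewrite mulr0n; apply/negPn/negP => /mcoeffMX_neq0 [m em /supp_ord0 hm].
have [z|nz] := eqVneq (m ord0 + m ord_max)%N 0%N.
  have m0 : m = 0%MM.
    by rewrite (mono_eta m) [RHS]mono_eta !mnm0E; congr mono; lia.
  rewrite m0 add0m in em.
  by case/negP: ne; rewrite eq_sym (gen_mono_inj em) eqxx.
apply: (@ord_ge_gen2 j); rewrite em.
apply: (ord_geM (u := 1) (v := 1)); last exact: ord_ge_gen.
by apply: order_ge1 => //; rewrite lt0n.
Qed.

Let P : pred 'I_(d + e) := [pred j | (j != last_x) && (j != last_y)].
Let z (i : 'I_#|P|) : R := wrc_gen k (enum_val i).

Lemma wrc_max_gen x : x \in J ->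
  exists a b (c : 'I_#|P| -> R), x = t1 * a + t2 * b + \sum_i c i * z i.
Proof.
pose W x := exists a b (c : 'I_#|P| -> R),
  x = t1 * a + t2 * b + \sum_i c i * z i.
have WD y1 y2 : W y1 -> W y2 -> W (y1 + y2).
  move=> [a [b [c ->]]] [a' [b' [c' ->]]].
  exists (a + a'), (b + b'), (fun i => c i + c' i).
  under [in RHS]eq_bigr => i _ do rewrite mulrDl.
  by rewrite big_split /=; ring.
have WM r y : W y -> W (r * y).
  move=> [a [b [c ->]]]; exists (r * a), (r * b), (fun i => r * c i).
  under [in RHS]eq_bigr => i _ do rewrite -mulrA.
  by rewrite -mulr_sumr; ring.
have W1 : W t1.
  exists 1, 0, (fun=> 0); rewrite big1 => [|i _]; last by rewrite mul0r.
  by ring.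
have Wz j : j != last_y -> W (wrc_gen k j).
  move=> ny; have [->|nx] := eqVneq j last_x; first exact: W1.
  have Pj : j \in P by rewrite inE nx ny.
  exists 0, 0, (fun i => (i == enum_rank_in Pj j)%:R).
  rewrite (bigD1 (enum_rank_in Pj j)) //= eqxx.
  rewrite big1 => [|i /negbTE ->]; last by rewrite mul0r.
  by rewrite /z enum_rankK_in // !mulr0 !add0r mul1r addr0.
have Wy : W (wrc_gen k last_y).
  have -> : wrc_gen k last_y = t2 + (-1) * wrc_gen k x0.
    by rewrite /t2 mulN1r addrAC subrr add0r.
  (* [Wz] covers x_0 both as one of the [z] and, when d = 1, as th1 itself. *)
  apply: WD; last by apply/WM/Wz; rewrite eq_lrshift.
  exists 0, 1, (fun=> 0); rewrite big1 => [|i _]; last by rewrite mul0r.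
  by ring.
move=> /wrc_maxP [c ->]; apply: (big_ind W) => [|y1 y2|j _]; last first.
- by apply: WM; have [->|] := eqVneq j last_y; [exact: Wy | exact: Wz].
- exact: WD.
by have := WM 0 _ W1; rewrite mul0r.
Qed.

Lemma wrc_max_indep (c : 'I_#|P| -> R) a b :
  Jpow 2 (\sum_i c i * z i - (t1 * a + t2 * b)) -> forall i, c i \in J.
Proof.
move=> /Jpow_supp h.
have zP (i : 'I_#|P|) : (enum_val i != last_x) && (enum_val i != last_y).
  exact: (enum_valP (A := P) i).
have coef j :
    c0 a *+ (last_x == j) + (c0 b *+ (x0 == j) + c0 b *+ (last_y == j)) =
    \sum_i c0 (c i) *+ (enum_val i == j).
  have : (wrc_eval (\sum_i c i * z i - (t1 * a + t2 * b)))@_(gen_mono j) = 0.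
    by apply/eqP/negPn/negP => /h /ord_ge_gen2.
  rewrite wrc_evalB wrc_eval_sum mcoeffB raddf_sum /= => /eqP.
  rewrite subr_eq0 => /eqP; under eq_bigr => i _ do rewrite coef_gen.
  move=> ->; rewrite ![_ * a]mulrC ![_ * b]mulrC mulrDr !wrc_evalD !mcoeffD.
  by rewrite !coef_gen.
(* The coefficient of y_(e-1), which is not among the [z], isolates the constant term of [b];
   otherwise that term would also enter the coefficient of x_0. *)
have b0 : c0 b = 0.
  have := coef last_y; rewrite !eq_lrshift eqxx !add0r big1 // => i _.
  by have /andP [_ /negbTE ->] := zP i.
move=> i; apply: c0_max; have := coef (enum_val i); rewrite b0 !mul0rn !addr0.
have /andP [/negbTE + _] := zP i; rewrite eq_sym => ->.
rewrite (bigD1 i) //= eqxx big1 ?addr0 => [e0|i' /negbTE ne].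
  exact: esym e0.
by rewrite (inj_eq enum_val_inj) ne.
Qed.

Lemma wrc_generalized_koszul : generalized_koszul J.
Proof.
apply: (@generalized_koszul_criterion _ J t1 t2 #|P| z).
- exact: wrc_gen_max.
- by apply: rpredD; apply: wrc_gen_max.
- by move=> i; apply: wrc_gen_max.
- exact: wrc_max_gen.
- move=> i j; have [|[a b] [Ja Jb e']] := @wrc_max_quad (z i * z j).
    by apply: (ideal_pow_mul (u := 1) (v := 1)); apply/ideal_pow1P/wrc_gen_max.
  by exists a, b.
- exact: wrc_max_reg1.
- exact: wrc_max_reg2.
- exact: wrc_max_indep.
Qed.

End Curve.

Theorem theorem2 (k : fieldType) (d e : nat) (hd : (1 <= d)%N) (he : (1 <= e)%N) :
  generalized_koszul (wrc_max_ideal k hd he).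
Proof. exact: wrc_generalized_koszul. Qed.
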